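(* There exists an integer $C\ge 1$ such that the following holds: Let $t\ge 1$ be an integer. For every integer $k\ge t$, if $G$ is a graph with $\mathrm{d}(G)\ge Ck$ and $G$ contains no $K_t$ minor, then $G$ contains a non-empty $k$-connected subgraph $H$ with $|V(H)|\le C^2\cdot t\cdot\log^3 t$.
   Context: All graphs are finite and simple. For a non-empty graph $G$, $\mathrm{d}(G)=|E(G)|/|V(G)|$ is its density. $\log$ is the natural logarithm. A $K_t$ minor is a complete graph on $t$ vertices obtained from a subgraph by contracting edges. *)

(* Defs.v *)
From HB Require Import structures.
From mathcomp Require Import all_boot all_order all_algebra.

Set Implicit Arguments.
Unset Strict Implicit.
Unset Printing Implicit Defensive.

Import Order.TTheory GRing.Theory Num.Theory.

Local Open Scope nat_scope.

(* A finite simple graph is a pair (V, E) with E a set of 2-element subsets of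
   V.  V need not be all of the ambient finite type T, so that subgraphs,
   vertex deletions and contractions of a graph over T are again over T. *)
Record sgraph (T : finType) := SGraph {
  vertices : {set T};
  edges : {set {set T}};
  edges_wf : [forall e in edges, (e \subset vertices) && (#|e| == 2)]
}.

Section Graphs.
Variable T : finType.
Implicit Types (G H J : sgraph T) (x y : T) (X : {set T}).

Definition adj G : rel T := fun x y => [set x; y] \in edges G.

Definition density (R : numFieldType) G : R :=
  (#|edges G|%:R / #|vertices G|%:R)%R.

Definition subgraph H G : bool :=
  (vertices H \subset vertices G) && (edges H \subset edges G).

Definition complete G : Prop :=
  {in vertices G &, forall x y, x != y -> adj G x y}.

Definition connected G : Prop :=
  vertices G != set0 /\ {in vertices G &, forall x y, connect (adj G) x y}.

Lemma del_vertices_wf G X :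
  [forall e in [set e in edges G | e \subset vertices G :\: X],
    (e \subset vertices G :\: X) && (#|e| == 2)].
Proof.
apply/forall_inP => e; rewrite inE => /andP[eE ->] /=.
by have /andP[] := forall_inP (edges_wf G) e eE.
Qed.

Definition del_vertices G X : sgraph T := SGraph (del_vertices_wf G X).

Definition k_connected (k : nat) G : Prop :=
  k < #|vertices G| /\
  forall X, X \subset vertices G -> #|X| < k -> connected (del_vertices G X).

(* Contraction of the edge xy: y is merged into x, whose name is kept by the
   new vertex; the loop coming from xy is dropped, and parallel edges are
   identified because the edges form a set. *)
Definition merge_vertex x y : T -> T := fun z => if z == y then x else z.

Lemma contract_wf G x y :
  [forall e in [set merge_vertex x y @: (e : {set T}) | e in edges G :\ [set x; y]],
    (e \subset merge_vertex x y @: vertices G) && (#|e| == 2)].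
Proof.
apply/forall_inP => _ /imsetP[e + ->]; rewrite !inE => /andP[neq eE].
have /andP[sub /eqP e2] := forall_inP (edges_wf G) e eE.
rewrite imsetS //= card_in_imset ?e2 // => a b ae be; rewrite /merge_vertex.
have pair_eq c d : c \in e -> d \in e -> c != d -> [set c; d] = e.
  move=> ce de cd; apply/eqP; rewrite eqEcard e2 cards2 cd andbT.
  by apply/subsetP => z; rewrite !inE => /orP[] /eqP ->.
have no_xy : y \in e -> x \in e -> x != y -> False.
  by move=> ye xe /(pair_eq _ _ xe ye) E; rewrite E eqxx in neq.
have [aE|ay] := eqVneq a y; have [bE|by_] := eqVneq b y => E.
- by rewrite aE bE.
- by case: no_xy; rewrite ?E -?aE // aE.
- by case: no_xy; rewrite -?E -?bE // bE.
- exact: E.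
Qed.

Definition contract G x y : sgraph T := SGraph (contract_wf G x y).

Inductive contraction G : sgraph T -> Prop :=
| contraction_refl : contraction G G
| contraction_step J x y :
    contraction G J -> adj J x y -> contraction G (contract J x y).

Definition has_complete_minor (t : nat) G : Prop :=
  exists H J, [/\ subgraph H G, contraction H J, complete J
                & #|vertices J| = t].

End Graphs.

(* Main.v *)
(* For X not too large, Mader's theorem turns e(X) >= 2k|X| into a k-connected
   subgraph inside X; so, arguing by contradiction, all vertex sets of size at
   most N = O(s^5 t) are sparse, where s ~ sqrt(log t); if k >= s t the graph
   itself is dense enough for the last step, so let k < s t.  By local sparsity
   vertex sets joined to each other by many edges expand.  After moving to a
   subgraph of large minimum degree, a balanced colouring cuts it into a large
   part A and two small parts BT and BC such that each vertex of A keeps many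
   neighbours in both.  If vertices of huge back-degree matter, they absorb
   private vertices of A and become the branch sets of a dense minor.
   Otherwise A is tiled by connected pieces with hubs in BT, and local expansion
   between A and BC grows, from each piece, balls that reach so many vertices of
   A that some vertex reached sees many new pieces; attaching a short path to it
   s times to each piece yields branch sets of a minor whose average degree is
   of order s k >= s t.  Finally such a dense minor contains a K_t minor by
   the argument of Kostochka and Thomason: pass to a family of connected sets in
   which every member is adjacent to more than 11/20 of the others, then pick
   random dominating (s+3)-tuples as branch sets. *)

Require Import Defs.
From mathcomp Require Import all_boot all_order all_algebra.
From mathcomp Require Import reals exp.
From mathcomp Require Import zify ring lra.
From Stdlib Require Import Classical_Prop.

Set Implicit Arguments.
Unset Strict Implicit.
Unset Printing Implicit Defensive.

(** A graph of density of order k >= t lacks a factor s ~ sqrt(log t) of what forces a K_t minor, so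
    a branch set has to collect s batches of order k neighbours. The obstacle is room: the vertices
    spent on all branch sets must remain a negligible fraction of A. Tiles are therefore large: each
    sees at least [mu] times as many vertices of A as a vertex of A has chosen neighbours, which
    leaves at most |A| / [mu] tiles. Up to constants [mu] is a product of three factors linear in s:
    the number of batches, the size of a connecting set, and the ratio of back-degrees to degrees
    that remains once huge back-degrees are excluded. Connecting sets have size O(s) because balls
    double at every step and need only outgrow a polynomial in s times k. There are two small parts
    so that connecting sets, which run through A and BC, never meet the hubs in BT. The hubs of the
    tiles already linked to a given one, which a ball must escape, number O(mu s k); with mu =
    O(s^3) and k < s t this is O(s^5 t), which is the N of local sparsity. *)

Ltac keep_arith :=
  repeat match goal with H : ?P |- _ =>
    lazymatch type of P with Prop =>
      lazymatch P with
      | is_true (leq _ _) => fail | is_true (andb (leq _ _) (leq _ _)) => fail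
      | @eq nat _ _ => fail
      | _ => clear H end end end.
Ltac nat_lia := keep_arith; lia.

(** For predicates without a decision procedure: it picks the most advanced extension state, the
    largest partial tile and the largest tiling. *)
Lemma ex_max (P : nat -> Prop) b : (exists n, P n) -> (forall n, P n -> n <= b) ->
  exists2 n, P n & forall m, P m -> m <= n.
Proof.
elim: b => [|b IH] [n Pn] Pb.
  by exists 0 => [|m /Pb//]; have := Pb _ Pn; rewrite leqn0 => /eqP <-.
have [Pb1|nPb1] := classic (P b.+1); first by exists b.+1.
apply: IH => [|m Pm]; first by exists n.
have := Pb _ Pm; rewrite leq_eqVlt => /orP[/eqP mb|//].
by case: nPb1; rewrite -mb.
Qed.

(** * Connectivity by cuts and edge counts *)

Section Basics.
Variables (T : finType) (e : rel T).

Definition linked (X Y : {set T}) := [exists x in X, exists y in Y, e x y].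

(** Cuts instead of paths, so that one notion serves vertices under [e] as well as families of sets
    under [setadj e]. *)
Definition conn (X : {set T}) :=
  (X != set0) &&
  [forall Q : {set T}, (Q != set0) && (Q \proper X) ==> linked Q (X :\: Q)].

Definition setadj : rel {set T} := fun X Y => (X != Y) && linked X Y.

Definition dg (W : {set T}) x := #|[set y in W | e x y]|.
(** Twice the number of edges inside [W] when [e] is symmetric and irreflexive. *)
Definition e2 (W : {set T}) := \sum_(x in W) dg W x.

Lemma linkedP (X Y : {set T}) : reflect (exists x y, [/\ x \in X, y \in Y & e x y]) (linked X Y).
Proof.
apply: (iffP exists_inP) => [[x xX /exists_inP[y yY exy]]|[x [y [xX yY exy]]]].
  by exists x, y.
by exists x => //; apply/exists_inP; exists y.
Qed.

Lemma linkedS (X Y X' Y' : {set T}) : X \subset X' -> Y \subset Y' -> linked X Y -> linked X' Y'.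
Proof.
move=> /subsetP sX /subsetP sY /linkedP[x [y [xX yY exy]]].
by apply/linkedP; exists x, y; split; auto.
Qed.

Lemma connP (X : {set T}) : reflect (X != set0 /\ forall Q : {set T}, Q != set0 -> Q \proper X ->
   linked Q (X :\: Q)) (conn X).
Proof.
apply: (iffP andP) => -[X0 H]; split => //.
  by move=> Q Q0 QX; move/forallP/(_ Q): H; rewrite Q0 QX.
by apply/forallP => Q; apply/implyP => /andP[Q0 QX]; apply: H.
Qed.

Lemma conn1 x : conn [set x].
Proof.
apply/connP; split; first by apply/set0Pn; exists x; rewrite set11.
move=> Q Q0; rewrite properEneq => /andP[Q1]; rewrite subset1.
by rewrite (negPf Q1) (negPf Q0).
Qed.

Hypothesis esym : symmetric e.

Lemma linked_sym : symmetric linked.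
Proof.
by move=> X Y; apply/linkedP/linkedP => -[x [y [xX yY exy]]]; exists y, x; rewrite esym.
Qed.

Lemma setadj_sym : symmetric setadj.
Proof. by move=> X Y; rewrite /setadj linked_sym eq_sym. Qed.

Lemma setadj_irr : irreflexive setadj.
Proof. by move=> X; rewrite /setadj eqxx. Qed.

Lemma connU (X Y : {set T}) : conn X -> conn Y ->
  (X :&: Y != set0) || linked X Y -> conn (X :|: Y).
Proof.
move=> /connP[X0 cX] /connP[Y0 cY] XY; apply/connP; split.
  by case/set0Pn: X0 => x xX; apply/set0Pn; exists x; rewrite inE xX.
move=> Q Q0 QXY.
(* A cut that splits one of the two sets is crossed inside that set. What remains is a cut
   containing one set and missing the other, and there the contact of the two sets decides. *)
have split1 (Z : {set T}) : Z \subset X :|: Y -> (forall Q : {set T}, Q != set0 -> Q \proper Z ->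
   linked Q (Z :\: Q)) -> Q :&: Z != set0 -> ~~ (Z \subset Q) -> linked Q ((X :|: Y) :\: Q).
  move=> sZ cZ Z0 ZQ; have /cZ: Q :&: Z \proper Z.
    rewrite properE subsetIr /=; apply: contra ZQ => /subset_trans; apply.
    exact: subsetIl.
  move/(_ Z0); apply: linkedS; rewrite ?subsetIl //.
  apply/subsetP => z; rewrite !inE => /andP[nzQ zZ].
  move/subsetP/(_ z zZ): sZ; rewrite inE => ->; rewrite andbT.
  by move: nzQ; rewrite zZ andbT.
have [QX|QX] := boolP (Q :&: X == set0); last first.
  have [sXQ|] := boolP (X \subset Q); last by apply: split1; rewrite ?subsetUl.
  have [QY|QY] := boolP (Q :&: Y == set0); last first.
    have [sYQ|] := boolP (Y \subset Q); last by apply: split1; rewrite ?subsetUr.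
    by move: QXY; rewrite properE subUset sXQ sYQ andbF.
  case/orP: XY => [/set0Pn[x]|].
    rewrite inE => /andP[/(subsetP sXQ) xQ xY].
    by move/eqP/setP/(_ x): QY; rewrite !inE xQ xY.
  apply: linkedS => //; apply/subsetP => y yY; rewrite !inE yY orbT andbT.
  by move/eqP/setP/(_ y): QY; rewrite !inE yY andbT => ->.
have sYQ : Q :&: Y != set0.
  case/set0Pn: Q0 => x xQ; apply/set0Pn; exists x; rewrite inE xQ /=.
  move/properP: QXY => [/subsetP/(_ x xQ)]; rewrite inE => /orP[xX|//] _.
  by move/eqP/setP/(_ x): QX; rewrite !inE xQ xX.
have [YQ|] := boolP (Y \subset Q); last by apply: split1; rewrite ?subsetUr.
case/orP: XY => [/set0Pn[x]|].
  rewrite inE => /andP[xX /(subsetP YQ) xQ].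
  by move/eqP/setP/(_ x): QX; rewrite !inE xQ xX.
rewrite linked_sym; apply: linkedS => //; apply/subsetP => y yY; rewrite !inE yY andbT.
by move/eqP/setP/(_ y): QX; rewrite !inE yY andbT => ->.
Qed.

Hypothesis eirr : irreflexive e.

Lemma dgU1 (W : {set T}) x y : x \notin W -> dg (x |: W) y = e y x + dg W y.
Proof.
move=> xW; rewrite /dg.
have [eyx|eyx] := boolP (e y x).
  have -> : [set z in x |: W | e y z] = x |: [set z in W | e y z].
    by apply/setP => z; rewrite !inE; have [->|] := eqVneq z x; rewrite ?eyx.
  by rewrite cardsU1 inE (negPf xW).
apply: eq_card => z; rewrite !inE; have [->|//] := eqVneq z x.
by rewrite (negPf eyx) (negPf xW).
Qed.

Lemma e2U1 (W : {set T}) x : x \notin W -> e2 (x |: W) = e2 W + 2 * dg W x.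
Proof.
move=> xW; rewrite /e2 big_setU1 //= dgU1 // eirr add0n.
rewrite (eq_bigr (fun y => e y x + dg W y)) => [|y _]; last by rewrite dgU1.
rewrite big_split /= -big_mkcondr /=.
have -> : \sum_(i in W | e i x) 1 = dg W x.
  by rewrite /dg -sum1_card; apply: eq_bigl => y; rewrite !inE esym.
lia.
Qed.

Lemma e2_le (W : {set T}) : e2 W <= #|W| * #|W|.
Proof.
rewrite /e2 -sum_nat_const; apply: leq_sum => x _.
by apply: subset_leq_card; apply/subsetP => y; rewrite inE => /andP[].
Qed.

End Basics.

(** * Families of disjoint connected sets *)

Section Packs.
Variables (T : finType) (e : rel T).
Hypothesis esym : symmetric e.
Notation lk := (setadj e).

Definition pack (P : {set {set T}}) := [forall X in P, conn e X] && trivIset P.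

Lemma packP (P : {set {set T}}) : reflect ((forall X, X \in P -> conn e X) /\
   (forall X Y, X \in P -> Y \in P -> X != Y -> [disjoint X & Y])) (pack P).
Proof.
apply: (iffP andP) => -[H1 H2]; split.
- exact/forall_inP.
- by move/trivIsetP: H2.
- exact/forall_inP.
- exact/trivIsetP.
Qed.

Lemma packS (P Q : {set {set T}}) : Q \subset P -> pack P -> pack Q.
Proof.
move=> /subsetP QP /packP[H1 H2]; apply/packP; split=> [X /QP|X Y /QP XP /QP]; auto.
Qed.

(** A cut of the union either splits a member, which is connected, or is a union of members and so
    induces a cut of the family. This turns branch sets made of sets back into branch sets of
    vertices. *)
Lemma conn_cover (F : {set {set T}}) : (forall X, X \in F -> conn e X) ->
  conn lk F -> conn e (cover F).
Proof.
move=> cF /connP[/set0Pn[X0 X0F] FF]; apply/connP; split.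
  have /connP[/set0Pn[x xX] _] := cF _ X0F.
  by apply/set0Pn; exists x; apply/bigcupP; exists X0.
move=> Q Q0 /properP[QF [z zF zQ]].
have [/exists_inP[X XF /andP[QX XQ]]|] :=
  boolP [exists X in F, (Q :&: X != set0) && ~~ (X \subset Q)].
  have /connP[_ cX] := cF _ XF.
  have /(cX _ QX) : Q :&: X \proper X.
    rewrite properE subsetIr /=; apply: contra XQ => /subset_trans; apply.
    exact: subsetIl.
  apply: linkedS; rewrite ?subsetIl //.
  apply/subsetP => y; rewrite !inE => /andP[nyQ yX].
  rewrite yX andbT in nyQ; rewrite nyQ /=; apply/bigcupP; by exists X.
rewrite negb_exists_in => /forall_inP alt.
have /FF : [set X in F | X \subset Q] != set0.
  case/set0Pn: Q0 => x xQ; have /bigcupP[X XF xX] := subsetP QF x xQ.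
  apply/set0Pn; exists X; rewrite inE XF /=.
  have := alt _ XF; rewrite negb_and negbK => /orP[/eqP/setP/(_ x)|/negPn//].
  by rewrite !inE xQ xX.
have -> : [set X in F | X \subset Q] \proper F.
  apply/properP; split; first by apply/subsetP => X; rewrite inE => /andP[].
  have /bigcupP[X XF zX] := zF; exists X => //; rewrite inE XF /=.
  by apply: contra zQ => /subsetP/(_ z zX).
move/(_ isT)/linkedP => [X [Y []]]; rewrite !inE => /andP[XF XQ] /andP[+ YF] /andP[_].
rewrite YF /= => YQ; apply: linkedS => //.
apply/subsetP => y yY; rewrite inE.
have := alt _ YF; rewrite YQ andbT negbK => /eqP/setP/(_ y).
rewrite !inE yY andbT => -> /=; by apply/bigcupP; exists Y.
Qed.

Lemma cover_disjoint (P F1 F2 : {set {set T}}) : pack P -> F1 \subset P -> F2 \subset P ->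
  [disjoint F1 & F2] -> [disjoint cover F1 & cover F2].
Proof.
move=> /packP[_ dP] /subsetP F1P /subsetP F2P dF.
rewrite -setI_eq0; apply/eqP/setP => x; rewrite !inE; apply/negP => /andP[].
move=> /bigcupP[X XF xX] /bigcupP[Y YF xY].
have [XY|XY] := eqVneq X Y.
  by move: (disjointFr dF XF); rewrite XY YF.
by move: (disjointFr (dP _ _ (F1P _ XF) (F2P _ YF) XY) xX); rewrite xY.
Qed.

(** Contracting the edge between [X] and [Y] loses that edge (the successor) and one edge for each
    common neighbour. *)
Lemma pack_merge (P : {set {set T}}) X Y : pack P -> X \in P -> Y \in P -> lk X Y ->
  exists P', [/\ pack P', #|P'|.+1 = #|P| &
    e2 lk P <= e2 lk P' + 2 * (#|[set Z in P | lk X Z && lk Y Z]|).+1].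
Proof.
move=> pP XP YP XY; have /packP[cP dP] := pP.
have lks := setadj_sym esym; have lki := @setadj_irr T e.
have nXY : X != Y by case/andP: XY.
set W := P :\ X :\ Y.
have YX : Y \in P :\ X by rewrite !inE eq_sym nXY YP.
have YW : Y \notin W by rewrite !inE eqxx.
have XW : X \notin Y |: W by rewrite setD1K // !inE eqxx.
have PE : P = X |: (Y |: W) by rewrite !setD1K.
have WP Z : Z \in W -> [/\ Z \in P, Z != X & Z != Y].
  by rewrite !inE => /and3P[].
have dW Z : Z \in W -> [disjoint X :|: Y & Z].
  move=> /WP[ZP ZX ZY]; rewrite disjoints_subset subUset -!disjoints_subset.
  by rewrite !dP // eq_sym.
have [x xX] : exists x, x \in X by apply/set0Pn; case/connP: (cP _ XP).
have UW : X :|: Y \notin W.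
  by apply/negP => /dW; rewrite -setI_eq0 setIid => /eqP/setP/(_ x); rewrite !inE xX.
exists ((X :|: Y) |: W); split.
- apply/packP; split.
    move=> Z /setU1P[->|/WP[ZP _ _]]; last exact: cP.
    by apply: connU; auto; rewrite (andP XY).2 orbT.
  move=> Z1 Z2 /setU1P[->|Z1W] /setU1P[->|Z2W] //; first by rewrite eqxx.
  + by rewrite dW.
  + by rewrite disjoint_sym dW.
  by have [[? _ _] [? _ _]] := (WP _ Z1W, WP _ Z2W); apply: dP.
- by rewrite PE !cardsU1 XW YW UW.
rewrite {1}PE (e2U1 lks lki XW) (e2U1 lks lki YW) (e2U1 lks lki UW).
rewrite (dgU1 _ _ YW) XY -!addnA leq_add2l.
have lkU Z : Z \in W -> lk (X :|: Y) Z = lk X Z || lk Y Z.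
  move=> ZW; have [ZP ZX ZY] := WP _ ZW.
  rewrite /setadj (eq_sym X Z) ZX (eq_sym Y Z) ZY /=.
  have -> /= : X :|: Y != Z.
    by apply: contraNneq UW => ->.
  apply/idP/orP => [/linkedP[a [b [/setUP[aX|aY] bZ ab]]]|[]].
  + by left; apply/linkedP; exists a, b.
  + by right; apply/linkedP; exists a, b.
  + by apply: linkedS; rewrite ?subsetUl.
  + by apply: linkedS; rewrite ?subsetUr.
have -> : dg lk W (X :|: Y) = #|[set Z in W | lk X Z] :|: [set Z in W | lk Y Z]|.
  apply: eq_card => Z; rewrite !inE -andb_orr; case ZW: (Z \in W); last first.
    by move: ZW; rewrite !inE => ->.
  by move: (ZW); rewrite !inE => -> /=; rewrite lkU.
have := cardsUI [set Z in W | lk X Z] [set Z in W | lk Y Z].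
have : #|[set Z in W | lk X Z] :&: [set Z in W | lk Y Z]| <=
  #|[set Z in P | lk X Z && lk Y Z]|.
  apply: subset_leq_card; apply/subsetP => Z; rewrite !inE.
  by case/andP=> /andP[/and3P[_ _ ->] ->] /andP[_ ->].
rewrite -!/(dg lk W _).
move: (#|_ :&: _|) (#|_ :|: _|) (#|[set Z in P | _]|) (dg lk W X) (dg lk W Y) => i u c a b.
by rewrite /=; nat_lia.
Qed.

Lemma pack_del (P : {set {set T}}) X : pack P -> X \in P ->
  [/\ pack (P :\ X), #|P :\ X|.+1 = #|P| & e2 lk P = e2 lk (P :\ X) + 2 * dg lk P X].
Proof.
move=> pP XP; have nX : X \notin P :\ X by rewrite !inE eqxx.
split; first by apply: packS pP; rewrite subD1set.
  by rewrite (cardsD1 X P) XP.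
have -> : dg lk P X = dg lk (P :\ X) X by rewrite -{1}(setD1K XP) dgU1 // setadj_irr.
by rewrite -{1}(setD1K XP) e2U1 //; [apply: setadj_sym|apply: setadj_irr].
Qed.

End Packs.

Lemma sum_ord_le m (F : 'I_m -> nat) c : (forall i, F i <= c) -> \sum_(i < m) F i <= m * c.
Proof.
move=> H; apply: (@leq_trans (\sum_(i < m) c)); first by apply: leq_sum => i _; apply: H.
by rewrite sum_nat_const card_ord.
Qed.

Lemma card_bigcup_le (I T : finType) (D : pred I) (F : I -> {set T}) :
  #|\bigcup_(i | D i) F i| <= \sum_(i | D i) #|F i|.
Proof.
elim/big_rec2: _ => [|i n X _ H]; first by rewrite cards0.
by apply: leq_trans (leq_card_setU _ _) _; rewrite leq_add2l.
Qed.

(** * Complete minors in graphs of large minimum degree *)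

Section Undominated.
Variables (T : finType) (e : rel T).
Implicit Types (W B R : {set T}).

Definition undom W B := [set x in W | [forall y in B, ~~ e y x]].

Lemma undomS W B B' : B \subset B' -> undom W B' \subset undom W B.
Proof.
move=> /subsetP BB; apply/subsetP => x; rewrite !inE => /andP[-> /forall_inP H] /=.
by apply/forall_inP => y /BB /H.
Qed.

(** Double counting of pairs (tuple, vertex missed by it): a vertex of [W] is adjacent to at least
    half of [R], so at most a fraction 1 / 2^a of the tuples miss it. *)
Lemma sum_undom W R a : symmetric e ->
  (forall x, x \in W -> 2 * #|R :\: [set y | e x y]| <= #|R|) ->
  (\sum_(f : {ffun 'I_a -> T} | f \in ffun_on R) #|undom W (f @: setT)|) * 2 ^ a
   <= #|W| * #|R| ^ a.
Proof.
move=> esym WR.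
have -> : \sum_(f : {ffun 'I_a -> T} | f \in ffun_on R) #|undom W (f @: setT)| =
  \sum_(x in W) #|R :\: [set y | e x y]| ^ a.
  transitivity (\sum_(f : {ffun 'I_a -> T} | f \in ffun_on R)
     \sum_(x in W | f \in ffun_on (R :\: [set y | e x y])) 1).
    apply: eq_bigr => f /ffun_onP fR; rewrite -sum1_card; apply: eq_bigl => x.
    rewrite inE; congr (_ && _); apply/forall_inP/ffun_onP => H.
      by move=> i; rewrite !inE fR andbT esym; apply: H; rewrite imset_f.
    by move=> y /imsetP[i _ ->]; have := H i; rewrite !inE esym => /andP[].
  rewrite (exchange_big_dep (mem W)) //=; last by move=> f x _ /andP[].
  apply: eq_bigr => x xW; rewrite sum1_card -[in RHS](card_ord a) -card_ffun_on.
  apply: eq_card => f; rewrite !inE /= unfold_in xW /=.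
  apply: andb_idl => /ffun_onP H; apply/ffun_onP => i.
  by have := H i; rewrite inE => /andP[].
rewrite big_distrl /= -sum_nat_const; apply: leq_sum => x xW.
rewrite mulnC -expnMn; case: a => [|a]; first by rewrite !expn0.
by rewrite leq_exp2r // WR.
Qed.

(* By averaging, at most half of the tuples leave too many vertices undominated;
   a random tuple lies inside a given U i with probability at most (4 / 2^a)^a. *)
Lemma good_tuple W R a m (U : nat -> {set T}) : symmetric e -> 0 < #|W| ->
  #|W| <= 2 * #|R| ->
  (forall x, x \in W -> 2 * #|R :\: [set y | e x y]| <= #|R|) ->
  (forall i, i < m -> #|U i| * 2 ^ a <= 2 * #|W|) ->
  2 * m * 4 ^ a < 2 ^ (a * a) ->
  exists f : {ffun 'I_a -> T}, [/\ forall i, f i \in R,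
    #|undom W (f @: setT)| * 2 ^ a <= 2 * #|W| &
    forall i, i < m -> exists j, f j \notin U i].
Proof.
move=> esym W0 RW WR Ub ma.
pose F := [set f : {ffun 'I_a -> T} | f \in ffun_on R].
have cF : #|F| = #|R| ^ a by rewrite cardsE card_ffun_on card_ord.
have R0 : 0 < #|R| by lia.
have F0 : 0 < #|F| by rewrite cF expn_gt0 R0.
pose bad1 (f : {ffun 'I_a -> T}) := 2 * #|W| < #|undom W (f @: setT)| * 2 ^ a.
pose bad2 (f : {ffun 'I_a -> T}) (i : 'I_m) := [forall j, f j \in U i].
have [/exists_inP[f]|] := boolP [exists f in F, ~~ bad1 f && [forall i, ~~ bad2 f i]].
  rewrite inE => /ffun_onP fR /andP[]; rewrite /bad1 -leqNgt => fb1 /forallP fb2.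
  exists f; split=> // i im; have := fb2 (Ordinal im).
  by rewrite negb_forall => /existsP[j]; exists j.
rewrite negb_exists_in => /forall_inP allbad.
have B1 : 2 * #|[set f in F | bad1 f]| <= #|F|.
  have H := sum_undom a esym WR.
  have : #|[set f in F | bad1 f]| * (2 * #|W|) <= #|W| * #|R| ^ a.
    apply: leq_trans H; rewrite -sum_nat_const big_distrl /= big_mkcond /=.
    rewrite [X in _ <= X]big_mkcond /=; apply: leq_sum => f _.
    by rewrite !inE; case: ifP => [/andP[-> /ltnW//]|_].
  by rewrite -cF mulnCA mulnA [X in X <= _]mulnC leq_pmul2l.
have B2 i : 2 * m * #|[set f in F | bad2 f i]| < #|F|.
  have B2i : #|[set f in F | bad2 f i]| <= #|U i| ^ a.
    rewrite -[in X in _ <= X](card_ord a) -card_ffun_on; apply: subset_leq_card.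
    by apply/subsetP => f; rewrite !inE => /andP[_ /forallP H]; apply/ffun_onP.
  have : #|U i| ^ a * 2 ^ (a * a) <= 4 ^ a * #|F|.
    rewrite cF -expnMn expnM -expnMn; case: a {F cF F0 bad1 bad2 B1 allbad B2i ma} Ub => // a Ub.
    by rewrite leq_exp2r //; apply: leq_trans (Ub _ _) _ => //; lia.
  set x := #|_| in B2i *; move: (#|U i| ^ a) (2 ^ (a * a)) (4 ^ a) ma B2i => u q p mp xu uq.
  have q0 : 0 < q by lia.
  rewrite -(ltn_pmul2r q0); apply: (@leq_ltn_trans (2 * m * p * #|F|)).
    by rewrite -!mulnA !leq_mul2l; apply/orP; right; apply/orP; right; apply: leq_trans uq;
      rewrite leq_mul2r xu orbT.
  by rewrite [X in _ < X]mulnC ltn_pmul2r.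
have : #|F| <= #|[set f in F | bad1 f]| + \sum_(i < m) #|[set f in F | bad2 f i]|.
  rewrite -!sum1_card; under [X in _ + X]eq_bigr do rewrite -sum1_card big_mkcond /=.
  rewrite exchange_big /= [X in X + _]big_mkcond [X in X <= _]big_mkcond -big_split /=.
  apply: leq_sum => f _.
  have inF (p : pred {ffun 'I_a -> T}) : (f \in [set f in F | p f]) = (f \in F) && p f.
    by rewrite in_set.
  rewrite inF; case fF : (f \in F) => //=.
  have /orP[->|/forallPn[i]] : bad1 f || ~~ [forall i, ~~ bad2 f i].
    by have := allbad f fF; rewrite negb_and negbK.
    by rewrite leq_addr.
  by rewrite negbK => bi; rewrite (bigD1 i) //= (inF (bad2^~ i)) fF bi /= addnCA leq_addr.
case: (posnP m) => [m0|m0].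
  rewrite big1; last by move=> [i im] _; exfalso; lia.
  by lia.
have : 2 * m * \sum_(i < m) #|[set f in F | bad2 f i]| <= m * (#|F| - 1).
  by rewrite big_distrr /=; apply: sum_ord_le => i; rewrite subn1 -ltnS prednK.
set S := \sum_(i < m) _; set b := #|[set f in F | bad1 f]| in B1 *.
move=> H1 H2; have : 2 * S <= #|F| - 1.
  by rewrite -(leq_pmul2l m0) mulnA [m * 2]mulnC.
lia.
Qed.

Hypothesis (esym : symmetric e).

(* Elements of A are joined to one of them through common neighbours. *)
Lemma connect_through W Z (A : {set T}) : A != set0 -> A \subset W ->
  (forall x y, x \in W -> y \in W -> exists z, [/\ z \in W :\: Z, e x z & e z y]) ->
  [disjoint A & Z] ->
  exists B, [/\ A \subset B, conn e B, B \subset W, [disjoint B & Z] & #|B| <= 2 * #|A|].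
Proof.
move=> /set0Pn[x0 x0A] AW com.
elim: {A}#|A| {-2}A (leqnn #|A|) x0A AW => [|n IH] A.
  by rewrite leqn0 cards_eq0 => /eqP ->; rewrite inE.
move=> An x0A AW dA; case: (set_0Vmem (A :\ x0)) => [A0|[x]].
  have -> : A = [set x0].
    apply/setP => y; rewrite inE; have [->//|yx] := eqVneq y x0.
    by move/setP/(_ y): A0; rewrite !inE yx.
  exists [set x0]; split=> //; rewrite ?conn1 ?sub1set ?cards1 ?(subsetP AW) //.
  by rewrite disjoints_subset sub1set inE (disjointFr dA x0A).
rewrite !inE => /andP[xx0 xA].
have cA : #|A| = #|A :\ x|.+1 by rewrite (cardsD1 x A) xA.
have [|||| B [AB cB BW dB Bc]] := IH (A :\ x).
- by rewrite -ltnS -cA.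
- by rewrite !inE eq_sym xx0.
- by apply: subset_trans AW; rewrite subD1set.
- by move: dA; apply: disjointWl; rewrite subD1set.
have [z [zW xz zx0]] := com x x0 (subsetP AW _ xA) (subsetP AW _ x0A).
exists (B :|: ([set x] :|: [set z])); split.
- apply/subsetP => y yA; rewrite !inE; have [->|yx] := eqVneq y x; first by rewrite orbT.
  by rewrite (subsetP AB) // !inE yx.
- apply: connU => //.
    apply: connU => //; rewrite ?conn1 //; apply/orP; right; apply/linkedP.
    by exists x, z; rewrite !set11.
  apply/orP; right; apply/linkedP; exists x0, z; rewrite !inE eqxx orbT esym zx0; split=> //.
  by apply: (subsetP AB); rewrite !inE eq_sym xx0.
- by move: zW; rewrite !subUset !sub1set inE BW (subsetP AW _ xA) => /andP[].
- move: zW; rewrite inE => /andP[zZ _].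
  rewrite disjoints_subset !subUset !sub1set !inE zZ -disjoints_subset dB andbT /=.
  by rewrite (disjointFr dA xA).
have := leq_of_leqif (leq_card_setU B ([set x] :|: [set z])).
have := leq_of_leqif (leq_card_setU [set x] [set z]); rewrite !cards1; nat_lia.
Qed.

Definition model t := exists f : nat -> {set T}, (forall i, i < t -> conn e (f i)) /\
  forall i j, i < j < t -> [disjoint f i & f j] && linked e (f i) (f j).

Definition model_in t W := exists f : nat -> {set T},
  (forall i, i < t -> conn e (f i) && (f i \subset W)) /\
  forall i j, i < j < t -> [disjoint f i & f j] && linked e (f i) (f j).

Lemma dense_model W s t : 0 < t -> t <= 2 ^ (s ^ 2) -> 80 * (s + 3) * t <= #|W| ->
  (forall x, x \in W -> 11 * #|W| <= 20 * dg e W x) -> model_in t W.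
Proof.
move=> t0 ts Wbig Wdeg; set a := s + 3; have aE : a = s + 3 by [].
clearbody a; pose v := #|W|.
have v0 : 0 < v by rewrite /v; nia.
suff H m : m <= t -> exists f : nat -> {set T},
   (forall i, i < m -> [&& conn e (f i), f i \subset W, #|f i| <= 2 * a &
      #|undom W (f i)| * 2 ^ a <= 2 * v]) /\
   forall i j, i < j < m -> [disjoint f i & f j] && linked e (f i) (f j).
  have [f [f1 f2]] := H t (leqnn t); exists f; split=> // i /f1 /and4P[-> -> _ _].
  by [].
elim: m => [|m IH] mt; first by exists (fun _ => set0); split=> // i j; rewrite ltn0 andbF.
have [f [f1 f2]] := IH (ltnW mt).
pose Z := \bigcup_(i < m) f i.
have Zc : 40 * #|Z| <= v.
  have : #|Z| <= \sum_(i < m) #|f i|.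
    exact: card_bigcup_le.
  have : \sum_(i < m) #|f i| <= m * (2 * a).
    apply: sum_ord_le => i.
    by case/and4P: (f1 i (ltn_ord i)).
  rewrite /v; nia.
pose R := W :\: Z.
have Rc : v <= #|R| + #|Z|.
  have := cardsID Z W; rewrite -/R -/v; have := subset_leq_card (subsetIr W Z); lia.
have RW : #|R| <= v by rewrite subset_leq_card // subsetDl.
have dgE x : dg e W x <= v by rewrite subset_leq_card //; apply/subsetP => y; rewrite inE => /andP[].
have WR x : x \in W -> 2 * #|R :\: [set y | e x y]| <= #|R|.
  move=> xW; have := Wdeg _ xW; rewrite -/v.
  have : dg e W x <= #|R :&: [set y | e x y]| + #|Z|.
    apply: leq_trans (leq_card_setU _ _); apply: subset_leq_card.
    by apply/subsetP => y; rewrite !inE => /andP[-> ->]; case: (y \in Z).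
  have := cardsID [set y | e x y] R; lia.
have com x y : x \in W -> y \in W -> exists z, [/\ z \in W :\: Z, e x z & e z y].
  move=> xW yW; have := Wdeg _ xW; have := Wdeg _ yW.
  have := cardsUI [set z in W | e x z] [set z in W | e y z].
  have : #|[set z in W | e x z] :|: [set z in W | e y z]| <= v.
    by apply: subset_leq_card; apply/subsetP => z; rewrite !inE => /orP[] /andP[].
  rewrite -/(dg e W x) -/(dg e W y) -/v.
  set I := _ :&: _ => H1 H2 H3 H4.
  have : ~~ (I \subset Z).
    by apply/negP => /subset_leq_card; lia.
  case/subsetPn => z; rewrite !inE => /andP[/andP[zW xz] /andP[_ yz]] zZ.
  by exists z; rewrite !inE zZ zW xz esym.
(* For a = s + 3, a^2 = s^2 + 2a + (4s + 3): the three terms pay for m < t <= 2^(s^2), for 4^a and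
   for the factor 2. *)
have ma : 2 * m * 4 ^ a < 2 ^ (a * a).
  have -> : a * a = s ^ 2 + (2 * a) + s.*2.*2.+3.
    by rewrite aE -!mul2n -mulnn mulnDl !mulnDr [s * 3]mulnC; lia.
  have e4 : 2 ^ (2 * a) = 4 ^ a by rewrite expnM.
  rewrite expnD (expnD 2 (s ^ 2)) e4.
  have : 0 < 4 ^ a by rewrite expn_gt0.
  have : 8 <= 2 ^ s.*2.*2.+3 by rewrite -[8]/(2 ^ 3) leq_exp2l.
  move: (2 ^ _.+3) (4 ^ a) (2 ^ (s ^ 2)) ts => p q r ts p8 q0.
  apply: (@leq_trans (8 * m.+1 * q)); first by nia.
  have -> : r * q * p = p * r * q by lia.
  by rewrite leq_mul2r leq_mul ?orbT //; lia.
have [|||g [gR gu gn]] := @good_tuple W R a m (fun i => undom W (f i)) esym v0 _ _ _ ma.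
- by rewrite -/v; lia.
- by move=> x /WR.
- by move=> i /f1 /and4P[].
pose A := g @: setT.
have A0 : A != set0.
  have i0 : 'I_a by exists 0; rewrite aE addn3.
  by apply/set0Pn; exists (g i0); apply: imset_f.
have AR : A \subset R by apply/subsetP => y /imsetP[i _ ->].
have Ac : #|A| <= a by rewrite -[X in _ <= X](card_ord a) -cardsT leq_imset_card.
have [|| B [AB cB BW dB Bc]] := @connect_through W Z A A0 _ com.
- by apply: subset_trans AR _; rewrite subsetDl.
- rewrite disjoints_subset; apply: subset_trans AR _.
  by apply/subsetP => y; rewrite !inE => /andP[].
exists (fun i => if i == m then B else f i); split.
  move=> i im; have [_|nim] := eqVneq i m; last by apply: f1; lia.
  rewrite cB BW (leq_trans Bc) ?leq_mul2l ?Ac //=; apply: leq_trans gu.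
  by rewrite leq_mul2r subset_leq_card ?undomS // orbT.
move=> i j ijm; have -> /= : (i == m) = false by apply/eqP; lia.
have [jm|njm] := eqVneq j m; last by apply: f2; lia.
have im : i < m by lia.
apply/andP; split.
  rewrite disjoint_sym; apply: disjointWr dB.
  by rewrite /Z (bigcup_sup (Ordinal im)).
have [l] := gn _ im; rewrite inE (subsetP (subset_trans AR (subsetDl _ _))) ?imset_f //=.
rewrite negb_forall_in => /exists_inP[y yi]; rewrite negbK => ey.
by apply/linkedP; exists y, (g l); split=> //; apply: (subsetP AB); rewrite imset_f.
Qed.

End Undominated.

(** * Complete minors in graphs of large average degree *)

Lemma ratio_max (U : finType) (D : pred U) (f g : U -> nat) x0 :
  D x0 -> (forall x, D x -> 0 < g x) ->
  exists2 x, D x & forall y, D y -> f y * g x <= f x * g y.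
Proof.
move=> Dx0 g0.
suff H (r : seq U) : exists2 x, D x & forall y, y \in r -> D y -> f y * g x <= f x * g y.
  by have [x Dx Hx] := H (enum U); exists x => // y; apply: Hx; rewrite mem_enum.
elim: r => [|z r [x Dx IH]]; first by exists x0.
have [Dz|nDz] := boolP (D z); last first.
  by exists x => // y /predU1P[->|/IH//]; rewrite (negPf nDz).
have [zx|xz] := leqP (f z * g x) (f x * g z).
  by exists x => // y /predU1P[->|/IH].
exists z => // y /predU1P[->//|/IH H Dy]; have {}H := H Dy.
rewrite -(leq_pmul2r (g0 _ Dx)) mulnAC (leq_trans (leq_mul H (leqnn _))) //.
by rewrite mulnAC [X in _ <= X]mulnAC leq_mul2r ltnW ?orbT.
Qed.

Section Kostochka.
Variables (T : finType) (e : rel T).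
Hypothesis esym : symmetric e.
Notation lk := (setadj e).
Implicit Types (P W : {set {set T}}).

Let lks := setadj_sym esym.
Let lki := @setadj_irr T e.

Lemma low_degree P : P != set0 -> exists2 X, X \in P & dg lk P X * #|P| <= e2 lk P.
Proof.
move=> P0; have [/exists_inP[X XP H]|] := boolP [exists X in P, dg lk P X * #|P| <= e2 lk P].
  by exists X.
rewrite negb_exists_in => /forall_inP H; exfalso.
have : #|P| * (e2 lk P).+1 <= e2 lk P * #|P|.
  rewrite {2}/e2 big_distrl -sum_nat_const /=; apply: leq_sum => X XP.
  by rewrite ltnNge H.
by move: P0; rewrite -card_gt0 => ?; rewrite mulnC leq_pmul2r // ltnn.
Qed.

Lemma dg_lt P X : X \in P -> dg lk P X < #|P|.
Proof.
move=> XP; apply: proper_card; apply/properP; split.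
  by apply/subsetP => Y; rewrite inE => /andP[].
by exists X => //; rewrite inE lki andbF.
Qed.

Lemma dg_nbr P X Y : dg lk [set Z in P | lk X Z] Y = #|[set Z in P | lk X Z && lk Y Z]|.
Proof. by apply: eq_card => Z; rewrite !inE andbA. Qed.

(** In a pack [Q] of maximal average degree no contraction raises the average, so an edge has, up to
    one, at least half the average degree as its number of common neighbours. If [X] has at most
    average degree, its neighbourhood is then a pack in which every member is adjacent to about half
    of the others. *)
Lemma mader_step P b : pack e P -> P != set0 -> 0 < b -> 2 * b * #|P| <= e2 lk P ->
  exists W, [/\ pack e W, W != set0 &
    forall Y, Y \in W -> #|W| <= 2 * (dg lk W Y).+1 /\ b <= (dg lk W Y).+1].
Proof.
move=> pP P0 b0 Pb.
have [||Q /andP[pQ Q0] Qmax] := @ratio_max _ (fun P => pack e P && (P != set0))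
   (e2 lk) (fun P => #|P|) P.
- by rewrite pP.
- by move=> P' /andP[_]; rewrite -card_gt0.
have Qb : 2 * b * #|Q| <= e2 lk Q.
  have := Qmax P; rewrite pP P0 => /(_ isT) H.
  rewrite -card_gt0 in P0; rewrite -(leq_pmul2r P0); apply: leq_trans H.
  by rewrite mulnAC leq_mul2r Pb orbT.
have [X XQ Xlow] := low_degree Q0; rewrite -card_gt0 in Q0.
exists [set Z in Q | lk X Z]; split.
- by apply: packS pQ; apply/subsetP => Z; rewrite inE => /andP[].
- apply/negP => /eqP N0; have dX : dg lk Q X = 0 by rewrite /dg N0 cards0.
  have [pQ1 cQ1 eQ1] := pack_del esym pQ XQ.
  have Q1 : Q :\ X != set0.
    rewrite -card_gt0 lt0n; apply/negP => /eqP Q10.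
    by move: eQ1 Qb; rewrite (cards0_eq Q10) dX /e2 big_set0 => ->; nia.
  have := Qmax (Q :\ X); rewrite pQ1 Q1 => /(_ isT); rewrite eQ1 dX -cQ1.
  nia.
move=> Y; rewrite inE => /andP[YQ XY].
have [Q' [pQ' cQ' eQ']] := pack_merge esym pQ XQ YQ XY.
rewrite -dg_nbr in eQ'; set c := (dg lk _ Y).+1 in eQ' *.
have Q'0 : Q' != set0.
  rewrite -card_gt0 lt0n; apply/negP => /eqP c0.
  have := cards1P (A := Q); rewrite -cQ' c0 => /(_ erefl)[Z QZ].
  by move: XQ YQ XY; rewrite QZ !inE => /eqP -> /eqP ->; rewrite lki.
have := Qmax Q'; rewrite pQ' Q'0 => /(_ isT); rewrite -/(dg lk Q X) in Xlow *.
move: Xlow Qb eQ' Q0; rewrite -cQ'; move: (dg lk Q X) (e2 lk Q) (e2 lk Q') (#|Q'|) => x E E' n.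
move=> H1 H2 H3 _ H5.
have H6 : E <= 2 * c * n.+1 by nia.
by split; rewrite -(leq_pmul2r (ltn0Sn n)); nia.
Qed.

(* Maximizing e2^2 / n^3, an edge lies in at least 3/5 * (average degree) triangles. *)
Lemma strong_mader_step W m : pack e W -> W != set0 -> 1 < m ->
  (forall Y, Y \in W -> #|W| <= 2 * (dg lk W Y).+1 /\ m <= (dg lk W Y).+1) ->
  exists V, [/\ pack e V, V != set0 & forall Y, Y \in V ->
    3 * #|V| <= 5 * (dg lk V Y).+1 /\ 3 * m.-1 <= 20 * (dg lk V Y).+1].
Proof.
move=> pW W0 m1 Wdeg; pose de := maxn m.-1 (uphalf #|W|).-1.
have Wde : #|W| * de <= e2 lk W.
  rewrite -sum_nat_const; apply: leq_sum => Y /Wdeg [H1 H2]; rewrite /de; lia.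
have de0 : 0 < de by rewrite /de; lia.
have W2 : #|W| <= 2 * de.+1 by rewrite /de; lia.
have mde : m.-1 <= de by rewrite /de; lia.
(* Maximising [e2] / n only gives the fraction 1/2; the exponent 3/2 of n pushes it beyond 11/20. In
   exchange the average degree of the maximiser must be bounded below through |W|, which is why [W]
   has size linear in its degrees. *)
have [||Q /andP[pQ Q0] Qmax] := @ratio_max _ (fun P => pack e P && (P != set0))
   (fun P => e2 lk P ^ 2) (fun P => #|P| ^ 3) W.
- by rewrite pW.
- by move=> P' /andP[_]; rewrite -card_gt0 expn_gt0 => ->.
have QW := Qmax W; rewrite pW W0 in QW; have {}QW := QW isT.
(* By maximality E^2 / n^3 >= de^2 / |W| >= de / 4; with E <= n^2 this forces de <= 4n, and then E /
   n >= de / 4. *)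
have Eb : de * #|Q| <= 4 * e2 lk Q.
  move: QW Wde W2 W0 Q0 (e2_le lk Q); rewrite -!card_gt0.
  move: (e2 lk Q) (e2 lk W) (#|W|) (#|Q|) => E w k n H1 H2 H3 H4 H5 H6.
  have H7 : (k * de) ^ 2 * n ^ 3 <= E ^ 2 * k ^ 3.
    by apply: leq_trans H1; rewrite leq_mul2r leq_sqr H2 orbT.
  have H8 : de ^ 2 * n ^ 3 <= E ^ 2 * k.
    have k2 : 0 < k ^ 2 by rewrite expn_gt0 H4.
    rewrite -(leq_pmul2l k2); move: H7; rewrite expnMn -!mulnA => H7.
    by apply: leq_trans H7 _; rewrite [k ^ 3]expnS; lia.
  have H9 : de * n ^ 3 <= 4 * E ^ 2.
    have kd : k <= 4 * de by lia.
    rewrite -(leq_pmul2l de0) mulnA mulnn; apply: leq_trans H8 _.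
    by move: (E ^ 2) => E2; nia.
  have H10 : de <= 4 * n.
    have n3 : 0 < n ^ 3 by rewrite expn_gt0 H5.
    rewrite -(leq_pmul2r n3); apply: leq_trans H9 _.
    rewrite -mulnA leq_mul2l /=; apply: leq_trans (_ : (n * n) ^ 2 <= _).
      by rewrite leq_sqr.
    by rewrite expnMn -expnD -expnS.
  have n1 : 0 < n by [].
  rewrite -leq_sqr !expnMn; apply: (@leq_trans (4 * (de * n ^ 3))).
    rewrite [n ^ 3]expnS; have := leq_mul H10 (leqnn (de * n ^ 2)); lia.
  by rewrite (_ : 4 ^ 2 = 4 * 4) // -(mulnA 4 4) leq_mul2l.
have [X XQ Xlow] := low_degree Q0; have Q0' := Q0; rewrite -card_gt0 in Q0'.
have E0 : 0 < e2 lk Q by nia.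
exists [set Z in Q | lk X Z]; split.
- by apply: packS pQ; apply/subsetP => Z; rewrite inE => /andP[].
- apply/negP => /eqP N0; have dX : dg lk Q X = 0 by rewrite /dg N0 cards0.
  have [pQ1 cQ1 eQ1] := pack_del esym pQ XQ.
  have Q1 : Q :\ X != set0.
    rewrite -card_gt0 lt0n; apply/negP => /eqP Q10.
    by move: eQ1 E0; rewrite (cards0_eq Q10) dX /e2 big_set0 => ->.
  have := Qmax (Q :\ X); rewrite pQ1 Q1 => /(_ isT).
  move: E0; rewrite eQ1 dX -cQ1 muln0 addn0 => E0.
  by rewrite leq_pmul2l ?expn_gt0 ?E0 // leq_exp2r // ltnn.
move=> Y; rewrite inE => /andP[YQ XY].
have [Q' [pQ' cQ' eQ']] := pack_merge esym pQ XQ YQ XY.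
rewrite -dg_nbr in eQ'; set c := (dg lk _ Y).+1 in eQ' *.
have Q'0 : Q' != set0.
  rewrite -card_gt0 lt0n; apply/negP => /eqP c0.
  have := cards1P (A := Q); rewrite -cQ' c0 => /(_ erefl)[Z QZ].
  by move: XQ YQ XY; rewrite QZ !inE => /eqP -> /eqP ->; rewrite lki.
have := Qmax Q'; rewrite pQ' Q'0 => /(_ isT).
rewrite -card_gt0 in Q'0; move: Q'0 Xlow Eb eQ' E0 Q0'; rewrite -/(dg lk Q X) -cQ'.
move: (dg lk Q X) (e2 lk Q) (e2 lk Q') (#|Q'|) => x E F n n0 H1 H2 H3 E0 _ H4.
(* Otherwise 2c < 6E / (5(n+1)), so the contraction keeps F > E (5n-1) / (5(n+1)). As (5n-1)^2 (n+1)
   >= 25 n^3 for n >= 1, it would beat [Q]. *)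
have H6 : 3 * E <= 5 * c * n.+1.
  rewrite leqNgt; apply/negP => H7.
  have H8 : (5 * n - 1) * E < 5 * n.+1 * F.
    have := leq_mul (leqnn n.+1) H3; rewrite mulnDr => H8.
    have [d nm] : exists d, 5 * n = d.+1 by exists (5 * n).-1; clear -n0; lia.
    have nE : 5 * n * E = d.+1 * E by rewrite nm.
    by rewrite nm subn1 /=; clear -H7 H8 nE; lia.
  have H9 : ((5 * n - 1) * E) ^ 2 < (5 * n.+1 * F) ^ 2 by rewrite ltn_sqr.
  have H10 : n.+1 * ((5 * n - 1) * E) ^ 2 < 25 * (F ^ 2 * n.+1 ^ 3).
    have -> : 25 * (F ^ 2 * n.+1 ^ 3) = n.+1 * (5 * n.+1 * F) ^ 2.
      by rewrite !expnMn [n.+1 ^ 3]expnS; move: (F ^ 2) (n.+1 ^ 2) => f v; clear; lia.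
    by rewrite ltn_pmul2l.
  have H11 : 25 * (E ^ 2 * n ^ 3) <= n.+1 * ((5 * n - 1) * E) ^ 2.
    have : 25 * n ^ 3 <= n.+1 * (5 * n - 1) ^ 2.
      by clear -n0; case: n n0 => // p _; rewrite !expnS !expn0; nia.
    move=> H; rewrite expnMn; move: H; move: (n ^ 3) ((5 * n - 1) ^ 2) (E ^ 2) => n3 v E2 H.
    by have := leq_mul H (leqnn E2); clear; lia.
  have H12 : 25 * (F ^ 2 * n.+1 ^ 3) <= 25 * (E ^ 2 * n ^ 3) by rewrite leq_mul2l.
  by have := leq_trans H10 (leq_trans H12 H11); rewrite ltnn.
have := leq_mul mde (leqnn n.+1); move: H1 H2 H6; clear; move: (m.-1) => v H1 H2 H6 H7.
by split; rewrite -(leq_pmul2r (ltn0Sn n)); lia.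
Qed.

Lemma dense_pack_model P s t : pack e P -> P != set0 -> 0 < t -> t <= 2 ^ (s ^ 2) ->
  1070 * ((s + 3) * t) * #|P| <= e2 lk P -> model e t.
Proof.
(* 535 makes 3(m-1) / 20 at least the 80(s+3)t that [dense_model] requires; the gap between 3/5 and
   11/20 absorbs the successor of the degree. *)
move=> pP P0 t0 ts Pdeg; set m := 535 * ((s + 3) * t).
have m1 : 1 < m by rewrite /m; lia.
have [||W [pW W0 Wdeg]] := @mader_step P m pP P0; [lia|by apply: leq_trans Pdeg; rewrite /m; lia|].
have [V [pV V0 Vdeg]] := strong_mader_step pW W0 m1 Wdeg.
have Vbig : 80 * (s + 3) * t <= #|V|.
  have [X XV] := set0Pn _ V0; have [_] := Vdeg _ XV; have := dg_lt XV; rewrite /m; lia.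
have [|f [f1 f2]] := @dense_model _ lk lks V s t t0 ts Vbig.
  move=> X XV; have [H1 _] := Vdeg _ XV; move: Vbig H1; move: (#|V|) (dg _ _ _) => v d.
  have : 1 <= t by []. nia.
have [cV dV] := packP _ _ pV.
exists (fun i => cover (f i)); split.
  move=> i it; have /andP[ci si] := f1 i it; apply: conn_cover ci.
  by move=> X /(subsetP si); apply: cV.
move=> i j ijt; have /andP[dij /linkedP[X [Y [Xi Yj /andP[_ XY]]]]] := f2 i j ijt.
have /andP[ij jt] := ijt.
have /andP[_ si] := f1 i (ltn_trans ij jt); have /andP[_ sj] := f1 j jt.
rewrite (cover_disjoint pV si sj dij) /=; apply: linkedS XY.
  by apply/bigcup_sup.
by apply/bigcup_sup.
Qed.

End Kostochka.

(** * Minors of simple graphs and Mader's theorem *)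

Section Sgraph.
Variable T : finType.
Implicit Types (G H J K : sgraph T).

Lemma adj_sym G : symmetric (adj G).
Proof. by move=> x y; rewrite /adj setUC. Qed.

Lemma adj_irr G : irreflexive (adj G).
Proof.
move=> x; apply/negP => xx; have := forall_inP (edges_wf G) _ xx.
by rewrite setUid cards1 andbF.
Qed.

Lemma adj_vertices G x y : adj G x y -> (x \in vertices G) && (y \in vertices G).
Proof.
by move=> xy; have := forall_inP (edges_wf G) _ xy; rewrite subUset !sub1set => /andP[].
Qed.

Lemma adj_del G X x y : adj (del_vertices G X) x y = [&& adj G x y, x \notin X & y \notin X].
Proof.
rewrite /adj inE subUset !sub1set !inE; case xy: (_ \in edges G) => //=.
by have /andP[-> ->] := adj_vertices xy; rewrite !andbT.
Qed.

Lemma del_subgraph G X : subgraph (del_vertices G X) G.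
Proof.
by rewrite /subgraph subsetDl; apply/subsetP => y; rewrite inE => /andP[].
Qed.

Lemma conn_in (e e' : rel T) (X : {set T}) : {in X &, e =2 e'} -> conn e X -> conn e' X.
Proof.
move=> ee /connP[X0 cX]; apply/connP; split=> // Q Q0 QX.
have /linkedP[x [y [xQ yQ exy]]] := cX _ Q0 QX; apply/linkedP; exists x, y; split=> //.
rewrite -ee //; first by apply: (subsetP (proper_sub QX)).
by move: yQ; rewrite inE => /andP[].
Qed.

Lemma conn_edge (e : rel T) (X : {set T}) : conn e X -> 1 < #|X| -> forall x, x \in X ->
  exists2 y, y \in X :\ x & e x y.
Proof.
move=> /connP[_ cX] X1 x xX.
have /cX : [set x] != set0 by apply/set0Pn; exists x; rewrite set11.
have -> : [set x] \proper X.
  by rewrite properEcard sub1set xX cards1.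
by move/(_ isT)/linkedP => [x' [y [/set1P -> ? ?]]]; exists y.
Qed.

Lemma contraction_trans G J K : contraction G J -> contraction J K -> contraction G K.
Proof.
move=> GJ; elim=> // J' x y _ IH xy; exact: contraction_step IH xy.
Qed.

Lemma adj_contract G x y u v : adj G u v -> [set u; v] != [set x; y] ->
  adj (contract G x y) (merge_vertex x y u) (merge_vertex x y v).
Proof.
move=> uv ne; apply/imsetP; exists [set u; v]; first by rewrite !inE ne.
by rewrite imsetU !imset_set1.
Qed.

(** Induction on the number of vertices: an edge xy inside some branch set is contracted, which
    removes [y] from that set and leaves the others alone, until all branch sets are singletons and
    the graph is complete. *)
Lemma branch_sets_contract G t f :
  (forall i, i < t -> conn (adj G) (f i)) ->
  (forall i j, i < j < t -> [disjoint f i & f j] && linked (adj G) (f i) (f j)) ->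
  (forall z, reflect (exists2 i, i < t & z \in f i) (z \in vertices G)) ->
  exists J, [/\ contraction G J, complete J & #|vertices J| = t].
Proof.
have [n] := ubnP #|vertices G|; elim: n => // n IH in G f *.
rewrite ltnS => Vn cf lf Vf.
have dis i j z : i < t -> j < t -> z \in f i -> z \in f j -> i = j.
  move=> it jt zi zj; have [ij|ji|//] := ltngtP i j.
    by have /andP[/disjointFr/(_ zi)] := lf i j ltac:(nat_lia); rewrite zj.
  by have /andP[/disjointFr/(_ zj)] := lf j i ltac:(nat_lia); rewrite zi.
have lnk i j : i < t -> j < t -> i != j -> linked (adj G) (f i) (f j).
  move=> it jt ij; have [ij1|ji|ij1] := ltngtP i j.
  - by have /andP[] := lf i j ltac:(nat_lia).
  - by rewrite linked_sym; [have /andP[] := lf j i ltac:(nat_lia)|exact: adj_sym].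
  - by rewrite ij1 eqxx in ij.
have [/existsP[i fi]|] := boolP [exists i : 'I_t, 1 < #|f i|]; last first.
  rewrite negb_exists => /forallP f1; exists G; split; first exact: contraction_refl.
    move=> x y /Vf[i it xi] /Vf[j jt yj] xy.
    have single l z : l < t -> z \in f l -> f l = [set z].
      move=> lt zl; apply/esym/eqP; rewrite eqEcard sub1set zl cards1 leqNgt.
      exact: (f1 (Ordinal lt)).
    have ij : i != j.
      apply: contraNneq xy => ij; move: yj; rewrite -ij (single i x) // => /set1P ->.
      by rewrite eqxx.
    have /linkedP[u [v []]] := lnk i j it jt ij.
    by rewrite (single i x) // (single j y) // => /set1P -> /set1P ->.
  have p (i : 'I_t) : {z | z \in f i}.
    have /connP[/set0Pn fi0 _] := cf i (ltn_ord i); exact: sigW.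
  have inj : injective (fun i : 'I_t => sval (p i)).
    move=> i j ij; apply: ord_inj; apply: (dis i j (sval (p i))) => //; first exact: (proj2_sig (p i)).
    rewrite ij; exact: (proj2_sig (p j)).
  rewrite -[RHS](card_ord t) -cardsT -(card_imset _ inj); apply: eq_card => z.
  apply/Vf/imsetP => [[i it zi]|[i _ ->]]; last by exists i => //; exact: (proj2_sig (p i)).
  exists (Ordinal it) => //; have /= yi := proj2_sig (p (Ordinal it)).
  have := f1 (Ordinal it); rewrite -leqNgt /= => /card_le1_eqP; exact.
have /connP[/set0Pn[x xi] _] := cf i (ltn_ord i).
have [y /setD1P[yx yi] xy] := conn_edge (cf i (ltn_ord i)) fi xi.
set m := merge_vertex x y; have my : m y = x by rewrite /m /merge_vertex eqxx.
have mE z : z != y -> m z = z by move=> zy; rewrite /m /merge_vertex (negPf zy).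
have mf l z : l < t -> z \in f l -> m z \in f l :\ y.
  move=> lt zl; have [zy|zy] := eqVneq z y; last by rewrite mE // !inE zy.
  rewrite zy my !inE eq_sym yx /=.
  by rewrite (dis l i z) // zy.
(* Only the edge xy itself disappears, and an edge between different branch sets cannot be xy. *)
have edge l l' u v : l < t -> l' < t -> u \in f l -> v \in f l' -> adj G u v ->
    (l != l') || ([set u; v] != [set x; y]) -> adj (contract G x y) (m u) (m v).
  move=> lt lt' ul vl uv ll; apply: adj_contract => //.
  case/orP: ll => // ll; apply: contraNneq ll => uvxy.
  apply/eqP; transitivity (i : nat).
    have : u \in [set x; y] by rewrite -uvxy set21.
    by case/set2P => ue; apply: (dis _ _ u) => //; rewrite ue.
  have : v \in [set x; y] by rewrite -uvxy set22.
  by case/set2P => ve; apply: (dis _ _ v) => //; rewrite ve.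
have [||||J [GJ cJ Jt]] := IH (contract G x y) (fun l => f l :\ y).
- apply: leq_trans Vn; rewrite (cardsD1 y (vertices G)).
  have -> : y \in vertices G by apply/Vf; exists i.
  rewrite ltnS; apply: subset_leq_card; apply/subsetP => _ /imsetP[z /Vf[l lt zl] ->].
  have := mf l z lt zl; rewrite !inE => /andP[-> ?]; apply/Vf; by exists l.
- move=> l lt; have [li|li] := eqVneq l i; last first.
    have yl : y \notin f l by apply: contra li => yl; apply/eqP/(dis l i y).
    have -> : f l :\ y = f l by apply/setP => z; rewrite !inE andb_idl // => zl; apply: contraNneq yl => <-.
    have /connP[f0 cfl] := cf l lt; apply/connP; split=> // Q Q0 Ql.
    have /linkedP[u [v [uQ vQ uv]]] := cfl _ Q0 Ql; apply/linkedP; exists u, v; split=> //.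
    have ul := subsetP (proper_sub Ql) u uQ.
    have vl : v \in f l by move: vQ; rewrite inE => /andP[].
    rewrite -(mE u) -1?(mE v) ?(edge l l) //; try by apply: contraNneq yl => <-.
    rewrite eqxx /=; apply/negP => /eqP/setP/(_ y); rewrite set22 => /set2P[] yE.
      by rewrite yE ul in yl.
    by rewrite yE vl in yl.
  subst l; have /connP[_ cfi] := cf i lt; apply/connP; split.
    by apply/set0Pn; exists x; rewrite !inE eq_sym yx.
  move=> Q Q0 /properP[Qi [z]]; rewrite !inE => /andP[zy zi] zQ.
  (* The cut is pulled back to the uncontracted branch set with [y] on the side of [x]. *)
  pose Q1 := if x \in Q then y |: Q else Q.
  have yQ : y \notin Q by apply/negP => /(subsetP Qi); rewrite !inE eqxx.
  have QQ1 : Q \subset Q1 by rewrite /Q1; case: ifP => // _; apply: subsetUr.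
  have Q1Q w : w \in Q1 -> m w \in Q.
    rewrite /Q1; case: ifP => xQ; rewrite ?inE.
      by have [->|wy] := eqVneq w y; rewrite ?my ?mE.
    by move=> wQ; rewrite mE //; apply: contraNneq yQ => <-.
  have Q1nQ w : w \in f i -> w \notin Q1 -> m w \in (f i :\ y) :\: Q.
    move=> wi; rewrite inE mf // andbT /Q1; case: ifP => xQ; rewrite ?inE ?negb_or.
      by move=> /andP[wy wQ]; rewrite mE.
    by have [->|wy] := eqVneq w y; rewrite ?my ?xQ ?mE.
  have /linkedP[u [v [uQ]]] : linked (adj G) Q1 (f i :\: Q1).
    apply: cfi; first by apply: contraNneq Q0 => Q10; rewrite -subset0 -Q10.
    apply/properP; split; last first.
      exists z => //; rewrite /Q1; case: ifP => //; by rewrite !inE (negPf zy).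
    apply/subsetP => w; rewrite /Q1; case: ifP => _; rewrite ?inE.
      by case/orP => [/eqP ->//|/(subsetP Qi)]; rewrite !inE => /andP[].
    by move/(subsetP Qi); rewrite !inE => /andP[].
  rewrite inE => /andP[vQ vi] uv; apply/linkedP; exists (m u), (m v); split; auto.
  have ui : u \in f i.
    move: uQ; rewrite /Q1; case: ifP => _; rewrite ?inE.
      by case/orP => [/eqP ->//|/(subsetP Qi)]; rewrite !inE => /andP[].
    by move/(subsetP Qi); rewrite !inE => /andP[].
  apply: (edge i i) => //; rewrite eqxx /=; apply/eqP => uvxy.
  have mm : m u = m v.
    have : u \in [set x; y] by rewrite -uvxy set21.
    have : v \in [set x; y] by rewrite -uvxy set22.
    have mx : m x = x by rewrite mE // eq_sym.
    by case/set2P => -> /set2P[] ->; rewrite ?my ?mx.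
  by have := Q1nQ v vi vQ; rewrite -mm inE Q1Q.
- move=> l l' ll; have /andP[dl ll1] := lf l l' ll; apply/andP; split.
    by apply: disjointWl (subD1set _ _) _; apply: disjointWr (subD1set _ _) dl.
  have /linkedP[u [v [ul vl uv]]] := ll1; apply/linkedP; exists (m u), (m v).
  have /andP[lt l't] := ll; have {}lt := ltn_trans lt l't.
  by split; [apply: mf|apply: mf|apply: (edge l l') => //; nat_lia].
- move=> z; apply: (iffP imsetP) => [[w /Vf[l lt wl] ->]|[l lt]].
    by exists l => //; apply: mf.
  rewrite !inE => /andP[zy zl]; exists z; last by rewrite -[merge_vertex _ _ _]/(m z) mE.
  by apply/Vf; exists l.
exists J; split=> //; apply: contraction_trans GJ.
by apply: contraction_step xy; apply: contraction_refl.
Qed.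

(** [adj G] is a relation on the whole type, so a one-vertex branch set could lie outside
    [vertices G]; for 1 < t its link to another branch set excludes this. *)
Lemma model_minor G t : 1 < t -> model (adj G) t -> has_complete_minor t G.
Proof.
move=> t1 [f [cf lf]]; pose X := \bigcup_(i < t) f i.
have XV : X \subset vertices G.
  apply/bigcupsP => i _; apply/subsetP => x xi.
  have [fi|fi] := ltnP 1 #|f i|.
    by have [y _ /adj_vertices/andP[]] := conn_edge (cf i (ltn_ord i)) fi xi.
  have fiE y : y \in f i -> y = x by move=> yi; exact: (card_le1_eqP fi).
  have [i0|i0] := posnP i.
    have /andP[_ /linkedP[u [v [ui _ /adj_vertices/andP[]]]]] := lf i 1 ltac:(nat_lia).
    by rewrite (fiE u ui).
  have i_t := ltn_ord i.
  have /andP[_ /linkedP[u [v [_ vi /adj_vertices/andP[]]]]] := lf 0 i ltac:(nat_lia).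
  by rewrite (fiE v vi).
pose H := del_vertices G (~: X).
have adjH i j : i < t -> j < t -> forall x y, x \in f i -> y \in f j -> adj G x y = adj H x y.
  move=> it jt x y xi yj; rewrite adj_del !inE !negbK.
  have -> : x \in X by apply/bigcupP; exists (Ordinal it).
  by have -> : y \in X; [apply/bigcupP; exists (Ordinal jt)|rewrite !andbT].
have [|||J [HJ cJ Jt]] := @branch_sets_contract H t f.
- by move=> i it; apply: conn_in (cf i it) => x y; apply: (adjH i i).
- move=> i j ij; have /andP[-> /linkedP[x [y [xi yj xy]]]] := lf i j ij.
  apply/linkedP; exists x, y; split=> //; rewrite -(adjH i j) //; nat_lia.
- move=> z; rewrite inE inE negbK; apply: (iffP andP) => [[/bigcupP[i _ zi] _]|[i it zi]].
    by exists (i : nat).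
  have zX : z \in X by apply/bigcupP; exists (Ordinal it).
  by rewrite zX (subsetP XV).
by exists H, J; split=> //; apply: del_subgraph.
Qed.

(* Mader: a smallest X with |X| >= 2k and e(X) > 2k(|X| - k) is k-connected. *)
Lemma mader_k_connected G k (X0 : {set T}) : 0 < k -> X0 != set0 -> X0 \subset vertices G ->
  4 * k * #|X0| <= e2 (adj G) X0 ->
  exists H, [/\ subgraph H G, vertices H != set0, k_connected k H & vertices H \subset X0].
Proof.
move=> k0 X00 X0V X0e; set e := adj G.
have esym : symmetric e := @adj_sym G; have eirr : irreflexive e := @adj_irr G.
pose P (X : {set T}) := [&& X \subset X0, 2 * k <= #|X| & 4 * k * #|X| < e2 e X + 4 * k * k].
have PX0 : P X0.
  rewrite /P subxx /=; move: X00 X0e (e2_le e X0); rewrite -card_gt0 -/e.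
  by move: (#|X0|) (e2 e X0) => n E; nia.
have [X /and3P[XX0 X2k Xe] Xmin] := arg_minnP (fun X : {set T} => #|X|) PX0.
have dgX v : v \in X -> dg e X v < #|X|.
  move=> vX; apply: proper_card; apply/properP; split.
    by apply/subsetP => y; rewrite inE => /andP[].
  by exists v => //; rewrite inE eirr andbF.
have X2k1 : 2 * k < #|X|.
  rewrite ltn_neqAle X2k andbT; apply/eqP => Xk.
  have : e2 e X <= #|X| * #|X|.-1.
    by rewrite -sum_nat_const; apply: leq_sum => v /dgX; case: (#|X|).
  by move: Xe; rewrite -Xk; nia.
have deg v : v \in X -> 2 * k < dg e X v.
  move=> vX; have cX : #|X| = #|X :\ v|.+1 by rewrite (cardsD1 v X) vX.
  have nP : ~~ P (X :\ v) by apply/negP => /Xmin; rewrite cX ltnn.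
  have eX : e2 e X = e2 e (X :\ v) + 2 * dg e X v.
    have -> : dg e X v = dg e (X :\ v) v.
      by rewrite -{1}(setD1K vX) dgU1 ?eirr // !inE eqxx.
    by rewrite -{1}(setD1K vX) e2U1 // !inE eqxx.
  move: nP; rewrite /P (subset_trans (subD1set _ _) XX0) /= negb_and -!ltnNge.
  by move: Xe; rewrite eX cX; nia.
have XV := subset_trans XX0 X0V.
pose H := del_vertices G (~: X).
have VH : vertices H = X.
  by apply/setP => z; rewrite !inE negbK andb_idr // => /(subsetP XV).
exists H; rewrite VH; split=> //; first exact: del_subgraph.
  by rewrite -card_gt0; nat_lia.
split; first by rewrite VH; nat_lia.
rewrite VH => S SX Sk.
have adjS x y : adj (del_vertices H S) x y =
    [&& e x y, x \in X :\: S & y \in X :\: S].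
  rewrite !adj_del !inE !negbK -/e.
  by case: (e x y); case: (x \in X); case: (y \in X); case: (x \in S); case: (y \in S).
have VS : vertices (del_vertices H S) = X :\: S by rewrite -VH.
split.
  rewrite VS -card_gt0; have := cardsID S X; have := subset_leq_card (subsetIr X S); nat_lia.
rewrite VS => x y xX yX; apply/negPn/negP => nxy.
set r := adj (del_vertices H S).
pose C := [set z in X :\: S | connect r x z].
have rsym : connect_sym r by apply: sym_connect_sym; apply: adj_sym.
(* These overlap exactly in [S], contain all edges between them, and have at least 2k vertices by
   the minimum degree. Minimality of [X] gives e(X) <= 2k(|U1| + |U2| - 2k) = 2k(|X| + |S| - 2k),
   too little since |S| < k. *)
pose U1 := C :|: S; pose U2 := X :\: C.
have CX : C \subset X by apply/subsetP => z; rewrite !inE => /andP[/andP[]].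
have CS z : z \in C -> z \notin S by rewrite !inE => /andP[/andP[]].
have stepC u v : u \in C -> v \in X -> e u v -> v \in U1.
  move=> uC vX uv; rewrite !inE vX; case vS: (v \in S); rewrite ?orbT //= orbF.
  move: (uC); rewrite inE => /andP[uXS xu]; apply: connect_trans xu _; apply: connect1.
  by rewrite /r adjS uv uXS inE vS vX.
have U1X : U1 \subset X by rewrite subUset CX SX.
have xC : x \in C by rewrite inE xX connect0.
have yC : y \notin C by rewrite inE yX.
have yS : y \notin S by move: yX; rewrite inE => /andP[].
have yX' : y \in X by move: yX; rewrite inE => /andP[].
have dgC v : v \in C -> dg e X v <= dg e U1 v.
  move=> vC; apply: subset_leq_card; apply/subsetP => z; rewrite !inE => /andP[zX vz].
  by rewrite vz andbT; have := stepC v z vC zX vz; rewrite !inE.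
have dgD v : v \in X -> v \notin C -> v \notin S -> dg e X v <= dg e U2 v.
  move=> vX vC vS; apply: subset_leq_card; apply/subsetP => z.
  rewrite in_set => /andP[zX vz]; rewrite in_set vz andbT in_setD zX andbT.
  apply/negP => zC; have := stepC z v zC vX; rewrite esym => /(_ vz).
  by rewrite inE (negPf vC) (negPf vS).
have U1k : 2 * k <= #|U1|.
  have := dgC x xC; have := deg x (subsetP CX _ xC).
  have : dg e U1 x <= #|U1| by apply: subset_leq_card; apply/subsetP => z; rewrite inE => /andP[].
  nat_lia.
have U2k : 2 * k <= #|U2|.
  have := dgD y yX' yC yS; have := deg y yX'.
  have : dg e U2 y <= #|U2| by apply: subset_leq_card; apply/subsetP => z; rewrite inE => /andP[].
  nat_lia.
have U1lt : #|U1| < #|X|.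
  apply: proper_card; apply/properP; split=> //; exists y => //.
  by rewrite inE (negPf yC) (negPf yS).
have U2lt : #|U2| < #|X|.
  apply: proper_card; apply/properP; split; first exact: subsetDl.
  by exists x; [exact: (subsetP CX)|rewrite inE xC].
have nP1 : ~~ P U1 by apply/negP => /Xmin; rewrite leqNgt U1lt.
have nP2 : ~~ P U2 by apply/negP => /Xmin; rewrite leqNgt U2lt.
have cU : #|U1| + #|U2| = #|X| + #|S|.
  have -> : #|U1| = #|C| + #|S|.
    rewrite cardsU; have -> : C :&: S = set0.
      by apply/setP => z; rewrite in_set0 inE; apply/negP => /andP[/CS/negPf ->].
    by rewrite cards0 subn0.
  have := cardsID C X; rewrite (setIidPr CX); rewrite -/U2; nat_lia.
have eU : e2 e X <= e2 e U1 + e2 e U2.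
  rewrite /e2 [X in X <= _]big_mkcond [X in _ <= X + _]big_mkcond [X in _ <= _ + X]big_mkcond.
  rewrite -big_split; apply: leq_sum => v _ /=.
  case vX: (v \in X) => //; have [vC|vC] := boolP (v \in C).
    by rewrite inE vC /= (leq_trans (dgC v vC)) ?leq_addr.
  have vU2 : v \in U2 by rewrite inE vC vX.
  rewrite vU2; have [vS|vS] := boolP (v \in S); last first.
    by rewrite (leq_trans (dgD v vX vC vS)) ?leq_addl.
  rewrite inE vS orbT; apply: leq_trans (leq_card_setU _ _); apply: subset_leq_card.
  apply/subsetP => z; rewrite !inE => /andP[zX ->]; rewrite zX /= !andbT.
  by case: (connect r x z); case: (z \in S).
move: nP1 nP2; rewrite /P (subset_trans U1X XX0) U1k (subset_trans (subsetDl _ _) XX0) U2k /=.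
rewrite -!leqNgt => h1 h2.
have : 4 * k * #|S| <= 4 * k * k by rewrite leq_mul2l ltnW ?orbT.
have : 4 * k * (#|U1| + #|U2|) = 4 * k * (#|X| + #|S|) by rewrite cU.
by rewrite !mulnDr; nat_lia.
Qed.

End Sgraph.

(** * Bipartite cores and balanced colourings *)

Lemma subset_card (T : finType) (X : {set T}) m : m <= #|X| ->
  exists2 Y : {set T}, Y \subset X & #|Y| = m.
Proof.
elim: m => [|m IH] mX; first by exists set0; rewrite ?sub0set ?cards0.
have [Y YX Ym] := IH (ltnW mX).
have /subsetPn[x xX xY] : ~~ (X \subset Y).
  by apply/negP => /subset_leq_card; rewrite Ym leqNgt mX.
by exists (x |: Y); rewrite ?subUset ?sub1set ?xX // cardsU1 xY Ym.
Qed.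

Section Bipartite.
Variables (T : finType) (R : T -> {set T}).
Implicit Types (A B : {set T}).

Definition bedges A B := \sum_(a in A) #|R a :&: B|.
Definition back A b := [set a in A | b \in R a].

Lemma bedgesE A B : bedges A B = \sum_(b in B) #|back A b|.
Proof.
rewrite /bedges; under eq_bigr do rewrite -sum1_card.
under [RHS]eq_bigr do rewrite -sum1_card.
rewrite (exchange_big_dep (mem B)) /=; last by move=> a b _; rewrite inE => /andP[].
apply: eq_bigr => b bB; apply: eq_bigl => a; rewrite !inE bB andbT.
by [].
Qed.

(** The pair maximises [c] times the edges plus a penalty for each discarded vertex. Discarding one
    more vertex does not help, which bounds its degree; comparison with (A, B) is the last
    inequality, from which users derive that the core is nonempty or large. The factor [c] allows
    fractional thresholds. *)
Lemma core A B c (al : nat) (be : T -> nat) :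
  exists A' B', [/\ A' \subset A, B' \subset B,
    forall a, a \in A' -> al <= c * #|R a :&: B'|,
    forall b, b \in B' -> be b <= c * #|back A' b| &
    c * bedges A B + al * #|A'| + \sum_(b in B') be b <=
    c * bedges A' B' + al * #|A| + \sum_(b in B) be b].
Proof.
pose F (p : {set T} * {set T}) := c * bedges p.1 p.2 + al * #|A :\: p.1| + \sum_(b in B :\: p.2) be b.
pose D (p : {set T} * {set T}) := (p.1 \subset A) && (p.2 \subset B).
have D0 : D (A, B) by rewrite /D !subxx.
have [[A' B'] /andP[/= A'A B'B] Fmax] := arg_maxnP F D0.
exists A', B'; split=> //.
- move=> a aA'.
  have DA : D (A' :\ a, B') by rewrite /D /= B'B (subset_trans (subD1set _ _) A'A).
  have := Fmax _ DA; rewrite /F /=.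
  have -> : bedges A' B' = #|R a :&: B'| + bedges (A' :\ a) B'.
    by rewrite /bedges (big_setD1 a).
  have -> : #|A :\: (A' :\ a)| = #|A :\: A'|.+1.
    have -> : A :\: (A' :\ a) = a |: (A :\: A').
      apply/setP => z; rewrite !inE; have [->|] := eqVneq z a; last by [].
      by rewrite (subsetP A'A).
    by rewrite cardsU1 !inE aA'.
  by rewrite mulnDr mulnS; lia.
- move=> b bB'.
  have DB : D (A', B' :\ b) by rewrite /D /= A'A (subset_trans (subD1set _ _) B'B).
  have := Fmax _ DB; rewrite /F /=.
  have -> : bedges A' B' = #|back A' b| + bedges A' (B' :\ b).
    by rewrite !bedgesE (big_setD1 b).
  have -> : B :\: (B' :\ b) = b |: (B :\: B').
    apply/setP => z; rewrite !inE; have [->|] := eqVneq z b; last by [].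
    by rewrite (subsetP B'B).
  rewrite big_setU1 ?inE ?bB' //= mulnDr; lia.
have := Fmax _ D0; rewrite /F /= !setDv cards0 big_set0 muln0 !addn0.
have -> : \sum_(b in B) be b = \sum_(b in B') be b + \sum_(b in B :\: B') be b.
  by rewrite (big_setID B') /= (setIidPr B'B).
have := cardsID A' A; rewrite (setIidPr A'A) => <-.
by rewrite mulnDr; lia.
Qed.

End Bipartite.

Section Coloring.
Variables (T : finType) (A : {set T}) (R : T -> {set T}) (r x : nat).
Hypothesis r0 : 0 < r.
Hypothesis Rc : forall a, a \in A -> #|R a| = 2 * x * r.

Let codeg (b b' : T) := #|[set a in A | (b \in R a) && (b' \in R a)]|.

Let codegC b b' : codeg b b' = codeg b' b.
Proof. by apply: eq_card => a; rewrite !inE [(b \in _) && _]andbC. Qed.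

Let cost (h : {ffun T -> 'I_r}) := \sum_b \sum_(b' | b' != b) codeg b b' * (h b == h b').

Let costE h b : cost h = 2 * (\sum_(b' | b' != b) codeg b b' * (h b == h b')) +
  \sum_(b1 | b1 != b) \sum_(b2 | (b2 != b1) && (b2 != b)) codeg b1 b2 * (h b1 == h b2).
Proof.
rewrite /cost (bigD1 b) //=.
have -> : \sum_(i | i != b) \sum_(b' | b' != i) codeg i b' * (h i == h b') =
  \sum_(i | i != b) codeg b i * (h b == h i) +
  \sum_(b1 | b1 != b) \sum_(b2 | (b2 != b1) && (b2 != b)) codeg b1 b2 * (h b1 == h b2).
  rewrite -big_split /=; apply: eq_bigr => i ib; rewrite (bigD1 b) /=; last by rewrite eq_sym.
  by rewrite codegC [h i == _]eq_sym.
by rewrite mul2n -addnn addnA.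
Qed.

(** A derandomised second moment. In a colouring with fewest monochromatic pairs inside the sets
    [R a], recolouring one vertex never helps, so averaging over the colours at most 1/r of all
    pairs are monochromatic. Since [R a] meets a class in 2x elements on average, few [a] can fall
    below x. *)
Lemma balanced_coloring : exists h : {ffun T -> 'I_r}, forall i,
  x * #|[set a in A | #|R a :&: [set b | h b == i]| < x]| <= 2 * r * #|A|.
Proof.
have [h _ hmin] := @arg_minnP _ ([ffun=> Ordinal r0] : {ffun T -> 'I_r}) xpredT cost isT.
exists h => i0.
have local b : r * (\sum_(b' | b' != b) codeg b b' * (h b == h b')) <=
    \sum_(b' | b' != b) codeg b b'.
  have : forall i, \sum_(b' | b' != b) codeg b b' * (h b == h b') <=
      \sum_(b' | b' != b) codeg b b' * (i == h b').
    move=> i; pose h' := [ffun b' => if b' == b then i else h b'].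
    have := hmin h' isT; rewrite (costE h b) (costE h' b).
    have -> : \sum_(b1 | b1 != b) \sum_(b2 | (b2 != b1) && (b2 != b)) codeg b1 b2 * (h' b1 == h' b2)
      = \sum_(b1 | b1 != b) \sum_(b2 | (b2 != b1) && (b2 != b)) codeg b1 b2 * (h b1 == h b2).
      apply: eq_bigr => b1 b1b; apply: eq_bigr => b2 /andP[_ b2b].
      by rewrite !ffunE (negPf b1b) (negPf b2b).
    have -> : \sum_(b' | b' != b) codeg b b' * (h' b == h' b') =
       \sum_(b' | b' != b) codeg b b' * (i == h b').
      by apply: eq_bigr => b' b'b; rewrite !ffunE eqxx (negPf b'b).
    by rewrite leq_add2r leq_mul2l.
  move=> H; have : \sum_(i < r) (\sum_(b' | b' != b) codeg b b' * (h b == h b')) <=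
     \sum_(i < r) \sum_(b' | b' != b) codeg b b' * (i == h b').
    by apply: leq_sum => i _; apply: H.
  rewrite sum_nat_const card_ord => /leq_trans; apply.
  rewrite exchange_big /=; apply: leq_sum => b' _; rewrite -big_distrr /=.
  rewrite (bigD1 (h b')) //= eqxx big1 ?muln1 // => i /negPf ->.
  by [].
have off : r * cost h <= \sum_b \sum_(b' | b' != b) codeg b b'.
  by rewrite /cost big_distrr; apply: leq_sum => b _; apply: local.
have sumcodeg : \sum_b \sum_(b' | b' != b) codeg b b' <= #|A| * ((2 * x * r) * (2 * x * r).-1).
  have -> : \sum_b \sum_(b' | b' != b) codeg b b' =
     \sum_(a in A) \sum_(b in R a) #|R a :\ b|.
    transitivity (\sum_b \sum_(a in A | b \in R a) #|R a :\ b|); last first.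
      rewrite (exchange_big_dep (mem A)) //= => [|b a _ /andP[]//].
      by apply: eq_bigr => a aA; apply: eq_bigl => b; rewrite aA.
    apply: eq_bigr => b _; rewrite /codeg; under eq_bigr do rewrite -sum1_card.
    rewrite (exchange_big_dep [pred a in A | b \in R a]) /=; last first.
      by move=> b' a _; rewrite inE => /andP[-> /andP[->]].
    apply: eq_bigr => a /andP[aA bR]; rewrite -sum1_card; apply: eq_bigl => b'.
    by rewrite !inE aA bR.
  rewrite -sum_nat_const; apply: leq_sum => a aA.
  rewrite -{1}(Rc aA) -sum_nat_const; apply: leq_sum => b bR.
  by rewrite -(Rc aA) (cardsD1 b (R a)) bR.
pose dgc a (i : 'I_r) := #|R a :&: [set b | h b == i]|.
have dsum a : a \in A -> \sum_i dgc a i = 2 * x * r.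
  move=> aA; rewrite -(Rc aA) -sum1_card (partition_big h xpredT) //=.
  apply: eq_bigr => i _; rewrite sum1_card; apply: eq_card => b.
  by rewrite !inE.
have dsq : \sum_(a in A) \sum_i dgc a i ^ 2 = cost h + #|A| * (2 * x * r).
  transitivity (\sum_(a in A) (\sum_(b in R a) \sum_(b' in R a) (h b == h b'))).
    apply: eq_bigr => a aA.
    transitivity (\sum_i \sum_(b in R a) \sum_(b' in R a) ((h b == i) && (h b' == i))).
      apply: eq_bigr => i _; rewrite -mulnn /dgc -sum1_card big_distrl /=.
      rewrite big_mkcond [RHS]big_mkcond; apply: eq_bigr => b _.
      rewrite !inE; case: (b \in R a) => //=; case: (h b == i) => /=; last by rewrite big1.
      rewrite mul1n big_mkcond [RHS]big_mkcond /=; apply: eq_bigr => b' _.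
      by rewrite !inE; case: (b' \in R a) => //=; case: (_ == _).
    rewrite exchange_big; apply: eq_bigr => b _; rewrite exchange_big; apply: eq_bigr => b' _ /=.
    rewrite (bigD1 (h b)) //= eqxx /= big1 ?addn0 ?[h b' == _]eq_sym // => i.
    by rewrite eq_sym => /negPf ->.
  have -> : cost h = \sum_(a in A) (\sum_(b in R a) \sum_(b' in R a | b' != b) (h b == h b')).
    transitivity (\sum_b \sum_(a in A | b \in R a) \sum_(b' in R a | b' != b) (h b == h b')).
      apply: eq_bigr => b _; rewrite /codeg.
      transitivity (\sum_(b' | b' != b) \sum_(a in A | (b \in R a) && (b' \in R a)) (h b == h b')).
        apply: eq_bigr => b' _; rewrite sum_nat_const; congr (_ * _).
        by apply: eq_card => a; rewrite !inE.
      rewrite (exchange_big_dep [pred a in A | b \in R a]) /=; last first.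
        by move=> b' a _ /and3P[-> ->].
      apply: eq_bigr => a /andP[aA bR]; apply: eq_bigl => b'.
      by rewrite aA bR /= andbC.
    rewrite (exchange_big_dep (mem A)) //= => [|b a _ /andP[]//].
    by apply: eq_bigr => a aA; apply: eq_bigl => b; rewrite aA.
  rewrite -sum_nat_const -big_split /=; apply: eq_bigr => a aA.
  rewrite -(Rc aA) -sum1_card -big_split /=; apply: eq_bigr => b bR.
  by rewrite (bigD1 b) //= eqxx addnC.
set bad := [set a in A | _].
have sq y z : 4 * z * y <= y ^ 2 + 4 * z ^ 2.
  by have := leq_of_leqif (nat_Cauchy (2 * z) y); rewrite expnMn; lia.
(* Chebyshev without division: (d - 2x)^2 >= 0 in every class, and it is at least x^2 where d < x in
   class [i0]. *)
have : \sum_(a in A) \sum_i (4 * x * dgc a i) + x ^ 2 * #|bad| <=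
   \sum_(a in A) \sum_i (dgc a i ^ 2 + 4 * x ^ 2).
  have -> : x ^ 2 * #|bad| = \sum_(a in A) (if a \in bad then x ^ 2 else 0).
    rewrite mulnC -sum_nat_const -big_mkcondr; apply: eq_bigl => a.
    by rewrite inE; case: (a \in A).
  rewrite -big_split /=; apply: leq_sum => a aA.
  rewrite (bigD1 i0) //= [X in _ <= X](bigD1 i0) //= addnAC; apply: leq_add; last first.
    by apply: leq_sum => i _; apply: sq.
  rewrite inE aA -/(dgc a i0) /=; case: ltnP => H; last by rewrite addn0 sq.
  move: (dgc a i0) H => y H; rewrite -(subnKC (ltnW H)) !expnS !expn0; nia.
rewrite (eq_bigr (fun=> 4 * x * (2 * x * r))); last first.
  by move=> a aA; rewrite -big_distrr /= dsum.
have -> : \sum_(a in A) \sum_i (dgc a i ^ 2 + 4 * x ^ 2) =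
   cost h + #|A| * (2 * x * r) + #|A| * (r * (4 * x ^ 2)).
  rewrite -dsq -sum_nat_const -big_split /=; apply: eq_bigr => a _.
  by rewrite big_split /= sum_nat_const card_ord.
rewrite sum_nat_const.
have [->|x0] := posnP x; first by [].
move: (leq_trans off sumcodeg) r0 x0; move: (cost h) (#|A|) (#|bad|) => c n b.
move: (r) (x) => r1 x1 H r0' x0 H2.
have H3 : c <= n * (2 * x1 * (2 * x1 * r1).-1).
  rewrite -(leq_pmul2l r0'); apply: leq_trans H _; lia.
have : x1 * (x1 * b) <= x1 * (2 * r1 * n).
  have [y yE] : {y | 2 * x1 * r1 = y.+1}.
    by exists (2 * x1 * r1).-1; rewrite prednK // !muln_gt0 x0 r0'.
  by move: H2 H3; rewrite !expnS !expn0 yE /=; nia.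
by rewrite leq_pmul2l.
Qed.

End Coloring.

(** * Extending branch sets and expansion under local sparsity *)

Lemma disjoint_setUl (T : finType) (A B C : {set T}) :
  [disjoint A :|: B & C] = [disjoint A & C] && [disjoint B & C].
Proof. by rewrite disjoints_subset subUset -!disjoints_subset. Qed.

Section Family.
Variables (T I : finType) (e : rel T).
Hypothesis esym : symmetric e.
Notation lk := (setadj e).

Lemma conn_disjoint_neq (X Y : {set T}) : conn e X -> [disjoint X & Y] -> X != Y.
Proof.
move=> /connP[/set0Pn[x xX] _] dXY; apply: contraTneq xX => XY.
by apply/negP => xX; move: (disjointFr dXY xX); rewrite -XY xX.
Qed.

Lemma family_pack (D : {set I}) (P : I -> {set T}) (X : I -> {set I}) :
  (forall i, i \in D -> conn e (P i)) ->
  (forall i j, i \in D -> j \in D -> i != j -> [disjoint P i & P j]) ->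
  (forall i, i \in D -> X i \subset D :\ i) ->
  (forall i j, i \in D -> j \in X i -> linked e (P i) (P j)) ->
  [/\ pack e (P @: D), #|P @: D| = #|D| & \sum_(i in D) #|X i| <= e2 lk (P @: D)].
Proof.
move=> cP dP XD lX.
have Pinj : {in D &, injective P}.
  move=> i j iD jD Pij; apply/eqP/negPn/negP => ij.
  by have := conn_disjoint_neq (cP _ iD) (dP _ _ iD jD ij); rewrite Pij eqxx.
split; first 1 last.
- exact: card_in_imset.
- rewrite /e2 big_imset //=; apply: leq_sum => i iD.
  rewrite -(card_in_imset (f := P) (D := mem (X i))); last first.
    move=> j l /(subsetP (XD _ iD)) /setD1P[_ jD] /(subsetP (XD _ iD)) /setD1P[_ lD].
    exact: Pinj.
  apply: subset_leq_card; apply/subsetP => _ /imsetP[j jX ->].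
  have /setD1P[ji jD] := subsetP (XD _ iD) _ jX.
  rewrite inE imset_f //= /setadj lX // andbT; apply: contra ji => /eqP Pij.
  by apply/eqP; apply: Pinj.
apply/packP; split=> [_ /imsetP[i iD ->]|_ _ /imsetP[i iD ->] /imsetP[j jD ->] ij].
  exact: cP.
by apply: dP => //; apply: contraNneq ij => ->.
Qed.

(* A state assigns to each i in D an extension E i of the branch set P0 i, and a
   list X i of neighbouring branch sets, built in n i <= q steps, each adding
   at most w vertices and exactly g neighbours. *)
Variables (D : {set I}) (P0 : I -> {set T}) (q w g : nat).

Definition ext_state (E : I -> {set T}) (X : I -> {set I}) (n : I -> nat) :=
  [/\ forall i, i \in D -> [/\ conn e (P0 i :|: E i), #|E i| <= n i * w, n i <= q,
        #|X i| = n i * g & X i \subset D :\ i],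
      forall i j, i \in D -> j \in D -> [disjoint E i & P0 j],
      forall i j, i \in D -> j \in D -> i != j -> [disjoint E i & E j] &
      forall i j, i \in D -> j \in X i -> linked e (P0 i :|: E i) (P0 j)].

Definition ext_step (E : I -> {set T}) (X : I -> {set I}) i (E' : {set T}) (X' : {set I}) :=
  [/\ forall j, j \in D -> [disjoint E' & P0 j] && [disjoint E' & E j],
      (#|E'| <= w) && (g <= #|X'|), conn e (P0 i :|: E'), X' \subset (D :\ i) :\: X i &
      forall j, j \in X' -> linked e E' (P0 j)].

(** A state with the largest total number of steps allows no further step, so a fraction 1/c of the
    members is complete, each with q * g neighbours. Links lead to the original sets [P0 j], so
    later extensions of [j] do not affect them. *)
Lemma extension_pack c :
  (forall i, i \in D -> conn e (P0 i)) ->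
  (forall i j, i \in D -> j \in D -> i != j -> [disjoint P0 i & P0 j]) ->
  (forall E X n, ext_state E X n -> #|D| <= c * #|[set i in D | n i == q]| \/
     exists i E' X', [/\ i \in D, n i < q & ext_step E X i E' X']) ->
  exists P, [/\ pack e P, #|P| = #|D| & #|D| * (q * g) <= c * e2 lk P].
Proof.
move=> cP0 dP0 progress.
pose S m := exists E X n, ext_state E X n /\ \sum_(i in D) n i = m.
have [||m [E [X [n [st sm]]]] mmax] := @ex_max S (#|D| * q).
- exists 0, (fun=> set0), (fun=> set0), (fun=> 0); split; last by rewrite big1.
  split=> [i iD|i j _ _|i j _ _ _|i j _]; rewrite ?inE //.
  + by rewrite setU0 cards0 sub0set cards0; split=> //; apply: cP0.
  + by rewrite -setI_eq0 set0I.
  + by rewrite -setI_eq0 set0I.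
- move=> m [E [X [n [[H _ _ _] <-]]]]; rewrite -sum_nat_const; apply: leq_sum => i /H.
  by case.
have [s1 s2 s3 s4] := st.
have [full|[i [E' [X' [iD niq [t1 /andP[t2 t5] t3 t4 t6]]]]]] := progress _ _ _ st; last first.
  exfalso.
  (* A step may offer more than [g] neighbours; trimming keeps |X i| = n i * g exact. *)
  have [X'' X''X' X''g] := subset_card t5.
  pose upd U (f : I -> U) v j := if j == i then v else f j.
  suff st' : ext_state (upd _ E (E i :|: E')) (upd _ X (X i :|: X'')) (upd _ n (n i).+1).
    have : S m.+1.
      exists (upd _ E (E i :|: E')), (upd _ X (X i :|: X'')), (upd _ n (n i).+1); split=> //.
      rewrite -sm (bigD1 i) //= [in RHS](bigD1 i) //= /upd eqxx addSn; congr (_ + _).+1.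
      by apply: eq_bigr => j /andP[_ /negPf ->].
    by move/mmax; rewrite ltnn.
  have dX : [disjoint X i & X''].
    rewrite -setI_eq0; apply/eqP/setP => z; rewrite !inE; apply/negP => /andP[zX zX''].
    by have := subsetP t4 _ (subsetP X''X' _ zX''); rewrite inE zX.
  split.
  - move=> j jD; rewrite /upd; have [->|ji] := eqVneq j i; last exact: s1.
    have [u1 u2 u3 u4 u5] := s1 _ iD; split=> //.
    + have -> : P0 i :|: (E i :|: E') = (P0 i :|: E i) :|: (P0 i :|: E') by rewrite setUACA setUid.
      apply: connU => //; apply/orP; left.
      have /connP[/set0Pn[z zP] _] := cP0 _ iD; apply/set0Pn; exists z.
      by rewrite !inE zP.
    + rewrite mulSn addnC; apply: leq_trans (leq_card_setU _ _) _; exact: leq_add.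
    + by rewrite cardsU (disjoint_setI0 dX) cards0 subn0 u4 X''g mulSn addnC.
    + rewrite subUset u5; apply: subset_trans X''X' _; apply: subset_trans t4 _.
      exact: subsetDl.
  - move=> j l jD lD; rewrite /upd; have [_|_] := eqVneq j i; last exact: s2.
    rewrite disjoints_subset subUset -!disjoints_subset s2 //=.
    by case/andP: (t1 l lD).
  - have dE l : l \in D -> l != i -> [disjoint E i :|: E' & E l].
      move=> lD li; rewrite disjoints_subset subUset -!disjoints_subset s3 //= 1?eq_sym //.
      by case/andP: (t1 l lD).
    move=> j l jD lD jl; rewrite /upd; case: eqP => ji; case: eqP => li.
    + by rewrite ji li eqxx in jl.
    + by apply: dE => //; apply/eqP.
    + by rewrite disjoint_sym; apply: dE => //; apply/eqP.
    exact: s3.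
  move=> j l jD; rewrite /upd; have [->|ji] := eqVneq j i; last exact: s4.
  case/setUP => [lX|/(subsetP X''X') lX'].
    by apply: linkedS (s4 _ _ iD lX) => //; rewrite setUA subsetUl.
  by apply: linkedS (t6 _ lX') => //; rewrite setUA subsetUr.
have [|||| pP cP eP] := @family_pack D (fun i => P0 i :|: E i) X.
- by move=> i /s1[].
- move=> i j iD jD ij; rewrite disjoint_setUl !(disjoint_sym _ (_ :|: _)) !disjoint_setUl.
  rewrite ![[disjoint _ & P0 i]]disjoint_sym ![[disjoint _ & E i]]disjoint_sym.
  by rewrite dP0 // (disjoint_sym (P0 i)) !s2 // s3.
- by move=> i /s1[].
- move=> i j iD jX; apply: linkedS (s4 _ _ iD jX) => //; exact: subsetUl.
exists ((fun i => P0 i :|: E i) @: D); split=> //.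
apply: leq_trans (_ : c * \sum_(i in D) #|X i| <= _); last by rewrite leq_mul2l eP orbT.
apply: leq_trans (_ : c * \sum_(i in [set i in D | n i == q]) #|X i| <= _); last first.
  rewrite leq_mul2l; apply/orP; right; rewrite big_mkcond [X in _ <= X]big_mkcond /=.
  by apply: leq_sum => i _; rewrite inE; case: (i \in D) => //=; case: ifP.
rewrite (eq_bigr (fun=> q * g)); last first.
  by move=> i; rewrite inE => /andP[/s1[_ _ _ -> _] /eqP ->].
by rewrite sum_nat_const [X in _ <= X]mulnA leq_mul2r full orbT.
Qed.

End Family.

Section Sparse.
Variables (T : finType) (e : rel T) (k N : nat).
Hypothesis esym : symmetric e.
Hypothesis sparse : forall X : {set T}, X != set0 -> #|X| <= N -> e2 e X < 4 * k * #|X|.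
Implicit Types (X Y : {set T}).

Lemma sparse_bip X Y : [disjoint X & Y] -> #|X| + #|Y| <= N ->
  \sum_(x in X) dg e Y x <= 2 * k * (#|X| + #|Y|).
Proof.
move=> dXY XYN; have [->|X0] := eqVneq X set0; first by rewrite big_set0.
have cXY : #|X :|: Y| = #|X| + #|Y| by rewrite cardsU (disjoint_setI0 dXY) cards0 subn0.
have := sparse (X := X :|: Y); rewrite cXY XYN => /(_ _ isT) H.
have {}H : e2 e (X :|: Y) < 4 * k * (#|X| + #|Y|).
  by apply: H; apply: contra X0; rewrite setU_eq0 => /andP[].
suff : 2 * \sum_(x in X) dg e Y x <= e2 e (X :|: Y) by lia.
have exch : \sum_(x in X) dg e Y x = \sum_(y in Y) dg e X y.
  rewrite /dg; under eq_bigr do rewrite -sum1_card.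
  under [RHS]eq_bigr do rewrite -sum1_card.
  rewrite (exchange_big_dep (mem Y)) /=; last by move=> a b _; rewrite inE => /andP[].
  by apply: eq_bigr => y yY; apply: eq_bigl => x; rewrite !inE yY esym.
rewrite mul2n -addnn {2}exch /e2.
have -> : \sum_(x in X :|: Y) dg e (X :|: Y) x =
   \sum_(x in X) dg e (X :|: Y) x + \sum_(x in Y) dg e (X :|: Y) x.
  by rewrite -bigU //; apply: eq_bigl => x; rewrite inE.
apply: leq_add; apply: leq_sum => x _; apply: subset_leq_card.
  by apply/subsetP => y; rewrite !inE => /andP[-> ->]; rewrite orbT.
by apply/subsetP => y; rewrite !inE => /andP[-> ->].
Qed.

(** If [Y] were smaller, the union would have at most (c+1)|X| <= N vertices but at least de |X|
    edges. *)
Lemma expand c de X Y : [disjoint X & Y] -> X != set0 -> (c.+1 * #|X|) <= N ->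
  0 < k -> 2 * k * c.+1 <= de -> (forall x, x \in X -> de <= dg e Y x) -> c * #|X| <= #|Y|.
Proof.
move=> dXY X0 XN k0 ck H; rewrite leqNgt; apply/negP => Yc.
have : #|X| * de <= \sum_(x in X) dg e Y x by rewrite -sum_nat_const; apply: leq_sum.
rewrite -card_gt0 in X0.
have /(sparse_bip dXY) : #|X| + #|Y| <= N by apply: leq_trans XN; rewrite mulSn; lia.
move: Yc ck X0; move: (#|X|) (#|Y|) (\sum_(x in X) _) => x y s; nia.
Qed.

(** Here only [Y] has to be small: an [X] at least as large is cut down to |Y| elements, and the
    union is too dense. *)
Lemma expand_lt de X Y : [disjoint X & Y] -> X != set0 -> 2 * #|Y| <= N ->
  4 * k < de -> (forall x, x \in X -> de <= dg e Y x) -> #|X| < #|Y|.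
Proof.
move=> dXY X0 YN ck H; rewrite ltnNge; apply/negP => YX.
have [X' X'X X'Y] := subset_card YX.
have : #|X'| * de <= \sum_(x in X') dg e Y x.
  by rewrite -sum_nat_const; apply: leq_sum => x /(subsetP X'X); apply: H.
have dX' : [disjoint X' & Y] by apply: disjointWl dXY.
have /(sparse_bip dX') : #|X'| + #|Y| <= N by lia.
have : 0 < #|Y|.
  case/set0Pn: X0 => x /H; rewrite lt0n; apply: contraTneq => /cards0_eq ->.
  rewrite -ltnNge /dg (eq_card0 (A := [set _ in _ | _])) //; first by lia.
  by move=> y; rewrite !inE.
rewrite X'Y; move: (#|Y|) (\sum_(x in X') _) => y s; nia.
Qed.

End Sparse.

(** * Vertices of large back-degree *)

Section Hubs.
Variables (T : finType) (e : rel T) (k N : nat).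
Hypothesis esym : symmetric e.
Hypothesis k0 : 0 < k.
Hypothesis sparse : forall X : {set T}, X != set0 -> #|X| <= N -> e2 e X < 4 * k * #|X|.
Implicit Types (A B X Y : {set T}) (R : T -> {set T}).
Notation lk := (setadj e).

Lemma dg_sub R X a : (forall y, y \in R a -> e a y) -> #|R a :&: X| <= dg e X a.
Proof.
by move=> H; apply: subset_leq_card; apply/subsetP => y; rewrite !inE => /andP[/H -> ->].
Qed.

(* Every hub absorbs q of its neighbours, each bringing x new neighbouring hubs. *)
Lemma hub_absorb A B R q x : [disjoint A & B] -> 0 < q -> 4 * k < x -> 4 * q * x <= N ->
  (forall a, a \in A -> [/\ 2 * x <= #|R a :&: B|, #|R a| <= 8 * x & forall y, y \in R a -> e a y]) ->
  (forall b, b \in B -> 20 * q * x <= #|back R A b|) ->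
  exists P, [/\ pack e P, #|P| = #|B| & #|B| * (q * x) <= 2 * e2 lk P].
Proof.
move=> dAB q0 kx qxN RA RB.
have nAB a : a \in A -> a \notin B by move=> aA; rewrite (disjointFr dAB aA).
apply: (@extension_pack T T e esym B (fun b => [set b]) q 1 x 2).
- by move=> b _; apply: conn1.
- by move=> i j _ _ ij; rewrite disjoints1 inE.
move=> E X n [s1 s2 s3 s4].
have [?|nfull] := leqP #|B| (2 * #|[set i in B | n i == q]|); [by left|right].
pose Z := \bigcup_(b in B) E b.
have Zc : #|Z| <= #|B| * q.
  apply: leq_trans (card_bigcup_le _ _) _; rewrite -sum_nat_const; apply: leq_sum => b /s1[_ + ? _ _].
  by rewrite muln1 => /leq_trans; apply.
pose NF := [set i in B | n i < q].
have NFc : #|B| < 2 * #|NF|.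
  have := cardsID [set i in B | n i == q] B.
  have -> : B :&: [set i in B | n i == q] = [set i in B | n i == q].
    by apply/setP => i; rewrite !inE; case: (i \in B).
  have -> : B :\: [set i in B | n i == q] = NF.
    apply/setP => i; rewrite !inE; case iB: (i \in B); rewrite ?andbF //=.
    by have [_ _ ? _ _] := s1 _ iB; rewrite andbT ltn_neqAle; case: eqP.
  lia.
(* At most |B|q vertices are used, each with at most 8x chosen neighbours, and more than half of the
   hubs are unfinished; on average an unfinished hub has at most 16qx used neighbours, which leaves
   4qx of its 20qx free. *)
have [/exists_inP[b bNF bZ]|] := boolP [exists b in NF, #|back R (A :&: Z) b| <= 16 * q * x];
    last first.
  rewrite negb_exists_in => /forall_inP H; exfalso.
  have H1 : #|NF| * (16 * q * x) <= bedges R (A :&: Z) NF.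
    rewrite bedgesE -sum_nat_const; apply: leq_sum => b /H; rewrite -ltnNge; exact: ltnW.
  have H2 : bedges R (A :&: Z) NF <= #|Z| * (8 * x).
    apply: (@leq_trans (\sum_(a in A :&: Z) 8 * x)).
      apply: leq_sum => a /setIP[/RA[_ H2 _] _]; apply: leq_trans H2.
      exact: subset_leq_card (subsetIl _ _).
    by rewrite sum_nat_const leq_mul2r subset_leq_card ?orbT // subsetIr.
  have x0 : 0 < x by lia.
  have qx : 0 < q * x by rewrite muln_gt0 q0.
  move: H1 H2 Zc NFc qx; move: (bedges _ _ _) (#|NF|) (#|Z|) (#|B|) => s u v w H1 H2 H3 H4 qx.
  have : v * (8 * x) <= w * q * (8 * x) by rewrite leq_mul2r H3 orbT.
  have : w * (q * x) < 2 * u * (q * x) by rewrite ltn_pmul2r.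
  by lia.
move: (bNF); rewrite inE => /andP[bB bq].
pose S := back R A b :\: Z; pose Y := b |: X b.
have [_ _ _ Xb XB] := s1 _ bB.
have Yc : #|Y| <= 2 * (q * x).
  have := leq_of_leqif (leq_card_setU [set b] (X b)); rewrite cards1 Xb -/Y.
  have : n b * x <= q * x by rewrite leq_mul2r ltnW ?orbT.
  have : 0 < q * x by rewrite muln_gt0 q0; lia.
  lia.
have Sc : 4 * (q * x) <= #|S|.
  have := RB _ bB; have := cardsID Z (back R A b).
  have -> : back R A b :&: Z = back R (A :&: Z) b.
    by apply/setP => a; rewrite !inE -!andbA [(a \in Z) && _]andbC.
  rewrite -/S; lia.
have YB : Y \subset B.
  by rewrite subUset sub1set bB (subset_trans XB) // subD1set.
(* Free neighbours of [b] that see too many of the hubs already linked. By [expand_lt] there are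
   fewer than |Y| <= 2qx of them, so some free neighbour has at least 2x - x new hubs. *)
pose W := [set a in S | x <= #|R a :&: Y|].
have /subsetPn[a aS aW] : ~~ (S \subset W).
  apply/negP => SW; have WY : #|W| < #|Y|.
    apply: (expand_lt esym sparse (de := x)) => //.
    - apply: disjointWr YB _; apply: disjointWl dAB.
      by apply/subsetP => a; rewrite !inE => /andP[/andP[_ /andP[]]].
    - rewrite -card_gt0; apply: leq_trans (subset_leq_card SW); apply: leq_trans Sc.
      by rewrite !muln_gt0 q0; lia.
    - lia.
    - move=> a; rewrite inE => /andP[aS xa]; apply: leq_trans xa _; apply: dg_sub.
      by move: aS; rewrite !inE => /andP[_ /andP[/RA[]]].
  have := subset_leq_card SW; have : 0 < q * x by rewrite muln_gt0 q0; lia.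
  lia.
move: aW; rewrite inE aS /= -ltnNge => aY.
move: aS; rewrite !inE => /andP[aZ /andP[aA baR]].
have [R1 R2 R3] := RA _ aA.
exists b, [set a], ((R a :&: B) :\: Y); split=> //; split.
- move=> j jB; rewrite !disjoints1 inE; apply/andP; split.
    by apply: contraTneq jB => <-; apply: nAB.
  by apply: contra aZ => aE; apply/bigcupP; exists j.
- rewrite cards1 /=; have := cardsID Y (R a :&: B).
  have -> : R a :&: B :&: Y = R a :&: Y by rewrite -setIA (setIidPr YB).
  lia.
- apply: connU; rewrite ?conn1 //; apply/orP; right; apply/linkedP; exists b, a.
  by rewrite !set11 esym R3.
- apply/subsetP => j; rewrite !inE negb_or => /andP[/andP[-> ->] /andP[_ ->]].
  by [].
move=> j; rewrite !inE => /andP[_ /andP[jR _]]; apply/linkedP; exists a, j.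
by rewrite !set11 R3.
Qed.

(* The vertices of back-degree at least h0 are so few that, if most of A sees
   many of them, each of them can absorb q private vertices of A. *)
Lemma split_hubs A B R q x : [disjoint A & B] -> 0 < q -> 4 * k < x -> 4 * q * x <= N ->
  A != set0 ->
  (forall a, a \in A -> [/\ #|R a| = 8 * x, R a \subset B & forall y, y \in R a -> e a y]) ->
  (exists P, [/\ pack e P, P != set0 & #|P| * (q * x) <= 2 * e2 lk P]) \/
  exists A' R', [/\ A' \subset A, #|A| <= 2 * #|A'|,
     forall a, a \in A' -> [/\ #|R' a| = 4 * x, R' a \subset B & R' a \subset R a] &
     forall b, b \in B -> #|back R' A' b| < 320 * q * x].
Proof.
move=> dAB q0 kx qxN A0 RA; pose h0 := 320 * q * x.
pose Bh := [set b in B | h0 <= #|back R A b|].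
pose A1 := [set a in A | 4 * x <= #|R a :&: Bh|].
pose A2 := [set a in A | 4 * x <= #|R a :\: Bh|].
have cA : #|A| <= #|A1| + #|A2|.
  apply: leq_trans (leq_card_setU _ _); apply: subset_leq_card; apply/subsetP => a aA.
  rewrite !inE aA /=; have [Rc _ _] := RA _ aA; have := cardsID Bh (R a); lia.
have x0 : 0 < x by lia.
have qx : 0 < q * x by rewrite muln_gt0 q0.
have [big2|big1] := leqP #|A| (2 * #|A2|).
  right; have [|R' R'P] := @fin_all_exists T (fun=> {set T})
      (fun a Ra => a \in A2 -> Ra \subset R a :\: Bh /\ #|Ra| = 4 * x); last first.
    exists A2, R'; split=> //; first by apply/subsetP => a; rewrite inE => /andP[].
      move=> a aA2; have [sR' ->] := R'P _ aA2; split=> //.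
        apply: subset_trans sR' _; apply: subset_trans (subsetDl _ _) _.
        by move: aA2; rewrite inE => /andP[/RA[]].
      exact: subset_trans sR' (subsetDl _ _).
    move=> b bB; have [->|[a]] := set_0Vmem (back R' A2 b); first by rewrite cards0 -mulnA muln_gt0.
    rewrite inE => /andP[aA2 /(subsetP (R'P _ aA2).1)]; rewrite !inE bB /= -ltnNge.
    move=> /andP[bh _]; apply: leq_trans bh; rewrite ltnS; apply: subset_leq_card.
    apply/subsetP => a'; rewrite !inE => /andP[a'A2 /(subsetP (R'P _ _).1)]; rewrite inE a'A2.
    by move=> /(_ isT); rewrite inE => /andP[_ ->]; case/andP: a'A2 => ->.
  move=> a; have [aA2|_] := boolP (a \in A2); last by exists set0.
  by move: (aA2); rewrite inE => /andP[_ /subset_card[Ra RaR Rc]]; exists Ra.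
left; have A1c : #|A| < 2 * #|A1| by lia.
(* The source of 320: |Bh| * 320qx <= 8x|A| <= 16x|A1|. *)
have BhA : 20 * q * #|Bh| <= #|A1|.
  have H1 : #|Bh| * h0 <= bedges R A Bh.
    by rewrite bedgesE -sum_nat_const; apply: leq_sum => b; rewrite inE => /andP[].
  have H2 : bedges R A Bh <= #|A| * (8 * x).
    rewrite -sum_nat_const; apply: leq_sum => a /RA[<- _ _]; exact: subset_leq_card (subsetIl _ _).
  rewrite -(leq_pmul2r x0) -(leq_pmul2r (isT : 0 < 16)).
  have : #|A| * (8 * x) <= 2 * #|A1| * (8 * x) by rewrite leq_mul2r ltnW ?orbT.
  by move: H1 H2; rewrite /h0; lia.
(* The 4x|A1| edges exceed the total penalty 2x|A1| + 20qx|Bh| <= 3x|A1|, so the core is not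
   empty. *)
have [A' [B' [A'A B'B degA degB]]] := core R A1 Bh 1 (2 * x) (fun=> 20 * q * x).
rewrite !sum_nat_const !mul1n => Ecore.
have E1 : #|A1| * (4 * x) <= bedges R A1 Bh.
  by rewrite -sum_nat_const; apply: leq_sum => a; rewrite inE => /andP[].
have B'0 : 0 < #|B'|.
  rewrite lt0n; apply/negP => /eqP B'0.
  have A'0 : #|A'| = 0.
    apply/eqP; rewrite cards_eq0; apply/negPn/negP => /set0Pn[a /degA].
    by rewrite (cards0_eq B'0) setI0 cards0; lia.
  move: Ecore; rewrite (cards0_eq A'0) (cards0_eq B'0) /bedges big_set0 cards0.
  rewrite -/(bedges R A1 Bh) muln0 mul0n !addn0 add0n.
  have : 20 * q * #|Bh| * x <= #|A1| * x by rewrite leq_mul2r BhA orbT.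
  have : 0 < #|A1| * x by rewrite muln_gt0 x0; lia.
  by move: E1; lia.
have A1A : A1 \subset A by apply/subsetP => a; rewrite inE => /andP[].
have BhB : Bh \subset B by apply/subsetP => a; rewrite inE => /andP[].
have [|||P [pP cP eP]] := @hub_absorb A' B' R q x _ q0 kx qxN.
- apply: disjointWl (subset_trans A'A A1A) _; exact: disjointWr (subset_trans B'B BhB) dAB.
- move=> a aA'; have [R1 R2 R3] := RA _ (subsetP (subset_trans A'A A1A) _ aA').
  by rewrite R1; split=> //; have := degA _ aA'; rewrite mul1n.
- by move=> b /degB; rewrite mul1n.
exists P; rewrite cP; split=> //; by rewrite -card_gt0 cP.
Qed.

End Hubs.

(** * Tilings *)

Section Tiling.
Variables (T : finType) (e : rel T) (k N : nat).
Hypothesis esym : symmetric e.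
Hypothesis k0 : 0 < k.
Hypothesis sparse : forall X : {set T}, X != set0 -> #|X| <= N -> e2 e X < 4 * k * #|X|.
Variables (A B : {set T}) (R : T -> {set T}) (y M : nat).
Hypothesis dAB : [disjoint A & B].
Hypothesis yk : 4 * k < y.
Hypothesis M0 : 0 < M.
Hypothesis MN : 2 * M <= N.
Hypothesis RA : forall a, a \in A -> [/\ #|R a| = 8 * y, R a \subset B & forall z, z \in R a -> e a z].
Hypothesis RB : forall b, b \in B -> #|back R A b| <= M.

(* A tile consists of hubs, of vertices connecting them, and of vertices of A
   adjacent to its hubs. *)
Definition hubs (g : {set T} * {set T} * {set T}) := g.1.1.
Definition links (g : {set T} * {set T} * {set T}) := g.1.2.
Definition seen (g : {set T} * {set T} * {set T}) := g.2.

Definition tile g :=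
  [/\ [/\ hubs g \subset B, links g \subset A & seen g \subset A],
      hubs g != set0 /\ conn e (hubs g :|: links g),
      forall a, a \in seen g -> R a :&: hubs g != set0,
      [/\ M <= #|seen g|, #|seen g| <= 2 * M & \sum_(b in hubs g) #|back R A b| <= 4 * #|seen g|] &
      #|hubs g| * (8 * y) <= 4 * M /\ #|links g| <= #|hubs g|].

Lemma backS (A1 A2 : {set T}) b : A1 \subset A2 -> back R A1 b \subset back R A2 b.
Proof. by move=> /subsetP H; apply/subsetP => a; rewrite !inE => /andP[/H ->]. Qed.

(** A part grows by a hub that meets the vertices already seen but has at least half of its
    neighbours outside them; a common neighbour becomes the link. If no such hub exists while fewer
    than M vertices are seen, let [W] be the hubs meeting [S F]: each has at least 4y neighbours in
    [S F], and each vertex of [S F] has at least y in [W], so [expand_lt] gives both |W| < |S F| and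
    |S F| < |W|. *)
Lemma grow_tile (A1 U : {set T}) : A1 \subset A -> U \subset B -> U != set0 ->
  (forall a, a \in A1 -> 2 * y <= 2 * #|R a :&: U|) ->
  (forall b, b \in U -> #|back R A b| + 16 * y <= 2 * #|back R A1 b|) ->
  exists g, [/\ tile g, hubs g \subset U & links g \subset A1].
Proof.
move=> A1A UB U0 degA degU.
pose S (F : {set T}) := \bigcup_(b in F) back R A1 b.
have SA1 F : S F \subset A1.
  by apply/bigcupsP => b _; apply/subsetP => a; rewrite inE => /andP[].
pose part (F L : {set T}) := [/\ [/\ F \subset U, F != set0 & L \subset A1], conn e (F :|: L),
  #|L| <= #|F|, \sum_(b in F) #|back R A1 b| <= 2 * #|S F| & #|F| * (8 * y) <= 2 * #|S F|].
have fin F L : part F L -> M <= #|S F| -> #|S F| <= 2 * M -> exists g, [/\ tile g, hubs g \subset U & links g \subset A1].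
  move=> [[FU F0 LA1] cFL LF sF cF] MF F2M; exists (F, L, S F); split=> //; split=> //=.
  - by rewrite /seen (subset_trans FU UB) (subset_trans LA1 A1A) (subset_trans (SA1 F) A1A).
  - move=> a /bigcupP[b bF]; rewrite inE => /andP[_ ab].
    by apply/set0Pn; exists b; rewrite inE ab.
  - rewrite /seen /hubs /=; split=> //; apply: leq_trans (_ : 2 * \sum_(b in F) #|back R A1 b| <= _); last by nat_lia.
    rewrite big_distrr /=; apply: leq_sum => b /(subsetP FU) /degU; nat_lia.
  by rewrite /hubs /links /=; split=> //; nat_lia.
have bk1 b : b \in U -> 8 * y <= #|back R A1 b| <= M.
  move=> bU; have := degU _ bU; have := RB (subsetP UB _ bU).
  have := subset_leq_card (backS b A1A); nat_lia.
have S1 b : S [set b] = back R A1 b by rewrite /S big_set1.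
have part1 b : b \in U -> part [set b] set0.
  move=> bU; have := bk1 _ bU; split; rewrite ?sub1set ?sub0set ?setU0 ?conn1 ?cards0 ?S1 ?cards1 ?big_set1 //.
  - by split=> //; apply/set0Pn; exists b; rewrite set11.
  - by nat_lia.
  - by nat_lia.
have [b0 b0U] := set0Pn _ U0.
have [big1|small1] := leqP M #|S [set b0]|.
  by apply: fin (part1 _ b0U) big1 _; rewrite S1; have := bk1 _ b0U; nat_lia.
pose P m := exists F L, [/\ part F L, #|S F| < M & #|F| = m].
have [||m [F [L [pF SF Fm]]] mmax] := @ex_max P #|T|.
- by exists 1, [set b0], set0; rewrite cards1; split=> //; apply: part1.
- by move=> m [F [L [_ _ <-]]]; apply: max_card.
have [[FU F0 LA1] cFL LF sF cF] := pF.
pose W := [set b in U | back R A1 b :&: S F != set0].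
have FW : F \subset W.
  apply/subsetP => b bF; rewrite inE (subsetP FU) //=; have := bk1 _ (subsetP FU _ bF).
  have -> : back R A1 b :&: S F = back R A1 b by apply/setIidPl/bigcup_sup.
  by rewrite -card_gt0; nat_lia.
have Se a b : a \in back R A1 b -> e a b.
  by rewrite inE => /andP[/(subsetP A1A) aA ab]; have [_ _] := RA aA; apply.
have dSU (Z : {set T}) : Z \subset U -> [disjoint Z & S F].
  move=> ZU; rewrite disjoint_sym; apply: disjointWr (subset_trans ZU UB) _.
  exact: disjointWl (subset_trans (SA1 _) A1A) dAB.
have WU : W \subset U by apply/subsetP => b; rewrite inE => /andP[].
have [/exists_inP[b bW /andP[bF bS]]|] :=
  boolP [exists b in W, (b \notin F) && (2 * #|back R A1 b :&: S F| <= #|back R A1 b|)].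
  move: bW; rewrite inE => /andP[bU /set0Pn[a /setIP[ab aS]]].
  have /bigcupP[b1 b1F ab1] := aS.
  have SbF : S (b |: F) = S F :|: back R A1 b by rewrite /S big_setU1 //= setUC.
  have cS : 2 * #|S F| + #|back R A1 b| <= 2 * #|S (b |: F)|.
    by rewrite SbF; have := cardsUI (S F) (back R A1 b); rewrite [S F :&: _]setIC; nat_lia.
  have bk := bk1 _ bU.
  have pF' : part (b |: F) (a |: L).
    split.
    - rewrite !subUset !sub1set bU FU LA1 (subsetP (SA1 F)) //; split=> //.
      by apply/set0Pn; exists b; rewrite setU11.
    - have -> : b |: F :|: (a |: L) = (F :|: L) :|: ([set a] :|: [set b]).
        by apply/setP => z; rewrite !inE; case: (z == a); case: (z == b); case: (z \in F); case: (z \in L).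
      apply: connU => //.
        apply: connU => //; rewrite ?conn1 //; apply/orP; right; apply/linkedP.
        by exists a, b; rewrite !set11 Se.
      apply/orP; right; apply/linkedP; exists b1, a; rewrite !inE b1F eqxx esym Se //.
    - by rewrite (cardsU1 b) bF; have := leq_of_leqif (leq_card_setU [set a] L); rewrite cards1; nat_lia.
    - by rewrite big_setU1 //=; nat_lia.
    - by rewrite (cardsU1 b) bF; nat_lia.
  have [big2|small2] := leqP M #|S (b |: F)|.
    apply: fin pF' big2 _; rewrite SbF; apply: leq_trans (leq_card_setU _ _) _; nat_lia.
  have : P m.+1 by exists (b |: F), (a |: L); rewrite cardsU1 bF Fm.
  by move/mmax; rewrite ltnn.
rewrite negb_exists_in => /forall_inP stuck; exfalso.
have SN : 2 * #|S F| <= N by nat_lia.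
have WS : #|W| < #|S F|.
  apply: (expand_lt esym sparse (de := 4 * y)) => //; [exact: dSU| |by nat_lia|].
    by apply: contra F0 => /eqP W0; rewrite -subset0 -W0.
  move=> b bW; apply: leq_trans (_ : #|back R A1 b :&: S F| <= _).
    have bk := bk1 _ (subsetP WU _ bW).
    have := stuck b bW; rewrite negb_and negbK => /orP[bF|]; last by nat_lia.
    have -> : back R A1 b :&: S F = back R A1 b by apply/setIidPl/bigcup_sup.
    by nat_lia.
  apply: subset_leq_card; apply/subsetP => a /setIP[ab aS].
  by rewrite inE aS esym Se.
have : #|S F| < #|W|.
  apply: (expand_lt esym sparse (de := y)) => //; [|by rewrite -card_gt0; nat_lia|by nat_lia|].
    by rewrite disjoint_sym; apply: dSU.
  move=> a aS; have aA1 := subsetP (SA1 F) _ aS; have := degA _ aA1; rewrite leq_pmul2l // => H.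
  apply: leq_trans H _; apply: subset_leq_card; apply/subsetP => b /setIP[bR bU].
  have ab : a \in back R A1 b by rewrite inE aA1.
  rewrite inE Se // andbT inE bU /=; apply/set0Pn; exists a; by rewrite inE ab.
by rewrite ltnNge ltnW.
Qed.

(** The [seen] sets may overlap, as they must: a vertex seen by many tiles is what links one branch
    set to many others. *)
Definition tiling (G : {set {set T} * {set T} * {set T}}) :=
  (forall g, g \in G -> tile g) /\
  (forall g h, g \in G -> h \in G -> g != h -> [disjoint hubs g & hubs h] /\ [disjoint links g & links h]).

(** In a tiling with most tiles that saw too little, the hubs would carry less than half of the
    edges between A and B, and the links, at most |B| <= |A| / 256 of them, only few; a core of the
    rest would yield another tile. *)
Lemma exists_tiling : 256 * #|B| <= #|A| -> A != set0 ->
  exists2 G, tiling G & #|A| * (8 * y) <= 8 * \sum_(g in G) #|seen g|.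
Proof.
move=> BA A0.
pose P m := exists G, tiling G /\ #|G| = m.
have [||m [G [[tG dG] Gm]] mmax] := @ex_max P #|{: {set T} * {set T} * {set T}}|.
- by exists 0, set0; rewrite cards0; split=> //; split=> g; rewrite ?inE // => h; rewrite inE.
- by move=> m [G [_ <-]]; apply: max_card.
exists G; first by split.
rewrite leqNgt; apply/negP => small.
pose HU := \bigcup_(g in G) hubs g; pose LU := \bigcup_(g in G) links g.
pose U := B :\: HU; pose A1 := A :\: LU.
have y0 : 0 < y by nat_lia.
have HUB : HU \subset B by apply/bigcupsP => g /tG[[]].
have HUsum : \sum_(b in HU) #|back R A b| <= 4 * \sum_(g in G) #|seen g|.
  rewrite big_distrr /=; apply: leq_trans (_ : \sum_(g in G) \sum_(b in hubs g) #|back R A b| <= _).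
    rewrite /HU (exchange_big_dep (mem HU)) /=; last first.
      by move=> g b gG bg; apply/bigcupP; exists g.
    apply: leq_sum => b /bigcupP[g gG bg]; rewrite (bigD1 g) /= ?leq_addr //.
    by rewrite gG.
  by apply: leq_sum => g /tG[_ _ _ [_ _ ?] _].
have LUc : #|LU| <= #|B|.
  apply: leq_trans (card_bigcup_le _ _) _.
  apply: leq_trans (_ : \sum_(g in G) #|hubs g| <= _).
    by apply: leq_sum => g /tG[_ _ _ _ []].
  apply: leq_trans (subset_leq_card HUB).
  rewrite -[#|HU|]sum1_card; under eq_bigr do rewrite -sum1_card.
  rewrite (exchange_big_dep (mem HU)) /=; last by move=> g b gG bg; apply/bigcupP; exists g.
  apply: leq_sum => b /bigcupP[g gG bg]; rewrite (bigD1 g) ?gG //= big1 // => h /andP[/andP[hG bh] hg].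
  by have [/disjointFr/(_ bh)] := dG h g hG gG hg; rewrite bg.
have EAB : bedges R A B = #|A| * (8 * y).
  by rewrite /bedges -sum_nat_const; apply: eq_bigr => a /RA[<- /setIidPl -> _].
have EAU : bedges R A U + \sum_(b in HU) #|back R A b| = bedges R A B.
  by rewrite !bedgesE [RHS](big_setID HU) /= (setIidPr HUB) addnC.
have EA1U : bedges R A U <= bedges R A1 U + #|B| * (8 * y).
  rewrite {1}/bedges (big_setID LU) /= addnC leq_add2l.
  apply: leq_trans (_ : \sum_(a in A :&: LU) (8 * y) <= _).
    apply: leq_sum => a /setIP[/RA[<- _ _] _]; exact: subset_leq_card (subsetIl _ _).
  rewrite sum_nat_const leq_mul2r; apply/orP; right; apply: leq_trans LUc.
  exact: subset_leq_card (subsetIr _ _).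
(* The threshold is half the back-degree in all of [A], because tiles bound that quantity; its
   penalty then sums to [bedges R A U], half of the doubled edge count. *)
have [A' [U' [A'A1 U'U degA degU]]] := core R A1 U 2 (2 * y) (fun b => #|back R A b| + 16 * y).
rewrite !big_split /= !sum_nat_const -!bedgesE => Ecore.
have UB : U \subset B by apply: subsetDl.
have A1A : A1 \subset A by apply: subsetDl.
have U'0 : U' != set0.
  apply/negP => /eqP U'0; move: Ecore; rewrite U'0.
  have -> : bedges R A' set0 = 0 by rewrite /bedges big1 // => a _; rewrite setI0 cards0.
  have -> : bedges R A set0 = 0 by rewrite /bedges big1 // => a _; rewrite setI0 cards0.
  rewrite cards0 => H.
  have H1 : 2 * y * #|A1| <= 2 * y * #|A| by rewrite leq_mul2l subset_leq_card ?orbT.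
  have H2 : #|U| * (16 * y) <= #|B| * (16 * y) by rewrite leq_mul2r subset_leq_card ?orbT.
  have H3 : 256 * #|B| * y <= #|A| * y by rewrite leq_mul2r BA orbT.
  have H4 : 0 < #|A| * y by rewrite muln_gt0 y0 card_gt0 A0.
  nat_lia.
have [g [tg gU gA]] := grow_tile (subset_trans A'A1 A1A) (subset_trans U'U UB) U'0 degA degU.
have dg h : h \in G -> [disjoint hubs g & hubs h] /\ [disjoint links g & links h].
  move=> hG; split; rewrite disjoints_subset.
    apply: subset_trans gU _; apply: subset_trans U'U _; apply/subsetP => b.
    by rewrite !inE => /andP[+ _]; apply: contra => bh; apply/bigcupP; exists h.
  apply: subset_trans gA _; apply: subset_trans A'A1 _; apply/subsetP => b.
  by rewrite !inE => /andP[+ _]; apply: contra => bh; apply/bigcupP; exists h.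
have gG : g \notin G.
  apply/negP => /dg[]; case: tg => _ [/set0Pn[z zg] _] _ _ _.
  by move/disjointFr/(_ zg); rewrite zg.
have : P m.+1.
  exists (g |: G); rewrite cardsU1 gG Gm; split=> //; split.
    by move=> h /setU1P[->|/tG].
  move=> h1 h2 /setU1P[->|h1G] /setU1P[->|h2G] h12; rewrite ?eqxx // in h12 *.
  - exact: dg.
  - by rewrite (disjoint_sym (hubs h1)) (disjoint_sym (links h1)); apply: dg.
  exact: dG.
by move/mmax; rewrite ltnn.
Qed.

End Tiling.

(** * Growing balls and merging tiles *)

Section Balls.
Variables (T : finType) (e : rel T) (k N : nat).
Hypothesis esym : symmetric e.
Hypothesis k0 : 0 < k.
Hypothesis sparse : forall X : {set T}, X != set0 -> #|X| <= N -> e2 e X < 4 * k * #|X|.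
Variables (A B : {set T}) (R : T -> {set T}) (z : nat).
Hypothesis dAB : [disjoint A & B].
Hypothesis zk : 6 * k <= z.
Hypothesis RA : forall a, a \in A -> 128 * z <= #|R a :&: B| /\ forall b, b \in R a -> e a b.
Hypothesis RB : forall b, b \in B -> z <= #|back R A b|.
Variable a0 : T.
Hypothesis a0A : a0 \in A.

(** The ball of [i] double steps around [a0], with a connected set in place of a path: that set is
    what will be added to a branch set. *)
Definition reach i := [set a | [exists p : {set T} * {set T},
  [&& p.1 \subset B, p.2 \subset A, #|p.1| <= i, #|p.2| <= i.+1 &
      [&& a \in p.2, a0 \in p.2 & conn e (p.1 :|: p.2)]]]].

Lemma reachP i a : reflect (exists C E : {set T}, [/\ C \subset B, E \subset A, #|C| <= i, #|E| <= i.+1 &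
   [/\ a \in E, a0 \in E & conn e (C :|: E)]]) (a \in reach i).
Proof.
rewrite inE; apply: (iffP existsP) => [[[C E] /= /and5P[h1 h2 h3 h4 /and3P[h5 h6 h7]]]|].
  by exists C, E; split.
move=> [C [E [h1 h2 h3 h4 [h5 h6 h7]]]]; exists (C, E) => /=.
by rewrite h1 h2 h3 h4 h5 h6 h7.
Qed.

Lemma reach0 : a0 \in reach 0.
Proof.
apply/reachP; exists set0, [set a0].
by rewrite sub0set sub1set a0A cards0 cards1 set11 set0U conn1.
Qed.

Lemma reachA i : reach i \subset A.
Proof. by apply/subsetP => a /reachP[C [E [_ /subsetP EA _ _ [/EA ]]]]. Qed.

Lemma reachS i a b a' : a \in reach i -> b \in R a -> b \in B -> a' \in back R A b ->
  a' \in reach i.+1.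
Proof.
move=> /reachP[C [E [CB EA Ci Ei [aE a0E cE]]]] bR bB; rewrite inE => /andP[a'A bR'].
have aA := subsetP EA _ aE.
apply/reachP; exists (b |: C), (a' |: E); rewrite !subUset !sub1set bB CB a'A EA; split=> //.
- by have := leq_of_leqif (leq_card_setU [set b] C); rewrite cards1; nat_lia.
- by have := leq_of_leqif (leq_card_setU [set a'] E); rewrite cards1; nat_lia.
rewrite setU11 inE a0E orbT; split=> //.
have -> : b |: C :|: (a' |: E) = (C :|: E) :|: ([set b] :|: [set a']).
  by apply/setP => u; rewrite !inE; case: (u == b); case: (u == a'); case: (u \in C); case: (u \in E).
apply: connU => //.
  apply: connU; rewrite ?conn1 //; apply/orP; right; apply/linkedP; exists b, a'.
  by rewrite !set11 esym; have [_ ->] := RA a'A.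
apply/orP; right; apply/linkedP; exists a, b; rewrite !inE aE orbT eqxx.
by have [_ ->] := RA aA.
Qed.

(** The passage from A to B does not shrink a set, and the return doubles it since z >= 6k = 2k(2 +
    1). The first step already gains the degree 128z of [a0]; beyond size [L] sparsity is no longer
    guaranteed. *)
Lemma ball_growth L i : 3 * L <= N -> 256 * z <= N ->
  L <= #|reach i.+1| \/ 2 ^ i * (128 * z) <= #|reach i.+1|.
Proof.
move=> LN zN; have z0 : 0 < z by nat_lia.
pose img (F : {set T}) := \bigcup_(b in F) back R A b.
have eimg (F : {set T}) b : b \in F -> F \subset B -> z <= dg e (img F) b.
  move=> bF /subsetP FB; apply: leq_trans (RB (FB _ bF)) _; apply: subset_leq_card.
  apply/subsetP => a ab; rewrite inE; apply/andP; split; first by apply/bigcupP; exists b.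
  by move: ab; rewrite inE esym => /andP[/RA[_ H] /H].
have dimg (F : {set T}) : F \subset B -> [disjoint F & img F].
  move=> FB; rewrite disjoint_sym; apply: disjointWr FB _; apply: disjointWl dAB.
  by apply/bigcupsP => b _; apply/subsetP => a; rewrite inE => /andP[].
elim: i => [|i [IH|IH]].
- right; rewrite mul1n; have [H _] := RA a0A.
  have [F FR Fc] := subset_card H.
  have FB : F \subset B by apply: subset_trans FR (subsetIr _ _).
  have -> : 128 * z = 1 * #|F| by rewrite Fc mul1n.
  apply: leq_trans (_ : #|img F| <= _).
    apply: (expand esym sparse (de := z)) => //; [exact: dimg| | |nat_lia|].
    + by rewrite -card_gt0 Fc; nat_lia.
    + by rewrite Fc; nat_lia.
    by move=> b bF; apply: eimg.
  apply: subset_leq_card; apply/subsetP => a /bigcupP[b /(subsetP FR)/setIP[bR bB]].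
  exact: reachS reach0 bR bB.
- left; apply: leq_trans IH _; apply: subset_leq_card; apply/subsetP => a /reachP[C [E [h1 h2 h3 h4 h5]]].
  by apply/reachP; exists C, E; split=> //; nat_lia.
have [big|small] := leqP L #|reach i.+2|; [by left|right].
have mono : reach i.+1 \subset reach i.+2.
  apply/subsetP => a /reachP[C [E [h1 h2 h3 h4 h5]]].
  by apply/reachP; exists C, E; split=> //; nat_lia.
set S := reach i.+1 in IH *.
have SL : #|S| < L by apply: leq_ltn_trans small; apply: subset_leq_card.
pose F0 := \bigcup_(a in S) (R a :&: B).
have SA : S \subset A by apply: reachA.
have F0B : F0 \subset B by apply/bigcupsP => a _; apply: subsetIr.
have F0c : #|S| <= #|F0|.
  rewrite -[#|S|]mul1n; apply: (expand esym sparse (de := 128 * z)) => //.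
  - by apply: disjointWl SA _; apply: disjointWr F0B dAB.
  - rewrite -card_gt0; apply: leq_trans IH; rewrite muln_gt0 expn_gt0; nat_lia.
  - nat_lia.
  - nat_lia.
  move=> a aS; have [H H'] := RA (subsetP SA _ aS); apply: leq_trans H _.
  apply: subset_leq_card; apply/subsetP => b bRB; rewrite inE; apply/andP; split.
    by apply/bigcupP; exists a.
  by case/setIP: bRB => /H'.
(* [F0] may be too large for [expand], so only |S| of its vertices are followed. *)
have [F FF0 Fc] := subset_card F0c.
have FB := subset_trans FF0 F0B.
rewrite expnS -mulnA; apply: leq_trans (_ : 2 * #|F| <= _); first by rewrite Fc leq_mul2l.
apply: leq_trans (_ : #|img F| <= _).
  apply: (expand esym sparse (de := z)) => //; [exact: dimg| | |nat_lia|].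
  + rewrite -card_gt0 Fc; apply: leq_trans IH; rewrite muln_gt0 expn_gt0; nat_lia.
  + by rewrite Fc; nat_lia.
  by move=> b bF; apply: eimg.
apply: subset_leq_card; apply/subsetP => a /bigcupP[b /(subsetP FF0)/bigcupP[a1 a1S /setIP[bR bB]]].
exact: reachS a1S bR bB.
Qed.

End Balls.

Section Merging.
Variables (T : finType) (e : rel T) (k N : nat).
Hypothesis esym : symmetric e.
Hypothesis k0 : 0 < k.
Hypothesis sparse : forall X : {set T}, X != set0 -> #|X| <= N -> e2 e X < 4 * k * #|X|.
Variables (A BT BC : {set T}) (RT RC : T -> {set T}) (z mu q j h : nat).
Hypothesis dAT : [disjoint A & BT].
Hypothesis dAC : [disjoint A & BC].
Hypothesis dTC : [disjoint BT & BC].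
Hypothesis A0 : A != set0.
Hypothesis BTA : 256 * #|BT| <= #|A|.
Hypothesis BCA : #|BC| <= #|A|.
Hypothesis zk : 6 * k <= z.
Hypothesis RTP : forall a, a \in A ->
  [/\ #|RT a| = 8 * (64 * z), RT a \subset BT & forall b, b \in RT a -> e a b].
Hypothesis RCP : forall a, a \in A ->
  [/\ #|RC a| = 8 * (64 * z), RC a \subset BC & forall b, b \in RC a -> e a b].
Hypothesis RTB : forall b, b \in BT -> #|back RT A b| <= h * (512 * z).
Hypothesis RCB : forall b, b \in BC -> #|back RC A b| <= h * (512 * z).
Hypothesis q0 : 0 < q.
Hypothesis h0 : 0 < h.
Hypothesis muE : 256 * q * (2 * j.+1).+1 * h <= mu.
Hypothesis jE : 16 * mu * q <= 2 ^ j.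
Hypothesis NE : 6 * 1024 * mu * q * z <= N.

Let M := mu * (512 * z).

Lemma merge_tiles : exists P, [/\ pack e P, P != set0 & #|P| * (q * (16 * z)) <= 1024 * e2 (setadj e) P].
Proof.
have z0 : 0 < z by nat_lia.
have mu0 : 0 < mu by apply: leq_trans muE; rewrite !muln_gt0 q0 h0.
have hmu : h <= mu by apply: leq_trans muE; rewrite leq_pmull // !muln_gt0 q0.
have M0 : 0 < M by rewrite !muln_gt0 mu0 z0.
have muqz : mu * z <= mu * q * z by rewrite leq_mul2r leq_pmulr ?orbT.
have MN : 2 * M <= N by apply: leq_trans NE; rewrite /M; nat_lia.
have RTB' b : b \in BT -> #|back RT A b| <= M.
  by move=> /RTB H; apply: leq_trans H _; rewrite leq_mul2r hmu orbT.
have y4 : 4 * k < 64 * z by nat_lia.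
have [G [tG dG] Gsum] := exists_tiling esym k0 sparse dAT y4 M0 MN RTP RTB' BTA A0.
pose F a := [set g in G | a \in seen g].
have tilehub g a : g \in G -> a \in seen g -> exists2 b, b \in hubs g & e a b.
  move=> gG ag; have [[_ _ /subsetP sA] _ H _ _] := tG g gG.
  have /set0Pn[b /setIP[bR bg]] := H a ag; exists b => //.
  by have [_ _] := RTP (sA a ag); apply.
(* Each tile seeing [a] has a hub in [RT a], and hubs of distinct tiles differ, so tiles are counted
   by hubs. *)
have FR a (X : {set _}) : a \in A -> #|F a :&: X| <= #|RT a :&: \bigcup_(g in X) hubs g|.
  move=> aA; pose b g := odflt a [pick b in RT a :&: hubs g].
  have bP g : g \in F a -> b g \in RT a :&: hubs g.
    rewrite inE => /andP[gG ag]; rewrite /b; case: pickP => //= none.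
    have [_ _ /(_ a ag)/set0Pn[c cR] _ _] := tG g gG.
    by have := none c; rewrite cR.
  rewrite -(card_in_imset (f := b)); last first.
    move=> g1 g2 /setIP[g1F _] /setIP[g2F _] b12.
    move: (bP _ g1F) (bP _ g2F); rewrite b12 => /setIP[_ b1] /setIP[_ b2].
    apply/eqP/negPn/negP => g12; move: g1F g2F; rewrite !inE => /andP[g1G _] /andP[g2G _].
    by have [/disjointFr/(_ b1)] := dG _ _ g1G g2G g12; rewrite b2.
  apply: subset_leq_card; apply/subsetP => _ /imsetP[g /setIP[gF gX] ->].
  by have /setIP[bR bg] := bP _ gF; rewrite inE bR; apply/bigcupP; exists g.
have Fle a : a \in A -> #|F a| <= 512 * z.
  move=> aA; have := FR a (F a) aA; rewrite setIid => /leq_trans; apply.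
  have [H _ _] := RTP aA; apply: leq_trans (subset_leq_card (subsetIl _ _)) _; nat_lia.
have Fsum (A' : {set T}) : A' \subset A -> \sum_(g in G) #|seen g :&: A'| = \sum_(a in A') #|F a|.
  move=> A'A; under eq_bigr do rewrite -sum1_card.
  under [RHS]eq_bigr do rewrite -sum1_card.
  rewrite (exchange_big_dep (mem A')) /=; last by move=> g a _ /setIP[].
  by apply: eq_bigr => a aA'; apply: eq_bigl => g; rewrite !inE aA' andbT.
have seenA g : g \in G -> seen g :&: A = seen g by move=> /tG[[_ _ /setIidPl]].
have FA : \sum_(g in G) #|seen g| = \sum_(a in A) #|F a|.
  by rewrite -Fsum //; apply: eq_bigr => g /seenA ->.
have GM : #|G| * mu <= #|A|.
  have z5 : 0 < 512 * z by nat_lia.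
  rewrite -(leq_pmul2r z5) -mulnA -/M; apply: leq_trans (_ : \sum_(g in G) #|seen g| <= _).
    by rewrite -sum_nat_const; apply: leq_sum => g /tG[_ _ _ [? _ _] _].
  by rewrite FA -sum_nat_const; apply: leq_sum => a /Fle.
pose LU := \bigcup_(g in G) links g.
have LUc : 256 * #|LU| <= #|A|.
  apply: leq_trans BTA; rewrite leq_mul2l /=.
  apply: leq_trans (card_bigcup_le _ _) _.
  apply: leq_trans (_ : \sum_(g in G) #|hubs g| <= _).
    by apply: leq_sum => g /tG[_ _ _ _ []].
  rewrite -sum1_card; under eq_bigr do rewrite -sum1_card.
  rewrite (exchange_big_dep (mem BT)) /=; last by move=> g b /tG[[/subsetP sub _ _] _ _ _ _] /sub.
  apply: leq_sum => b bB; rewrite sum1_card; apply/card_le1_eqP => g1 g2 /andP[g1G b1] /andP[g2G b2].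
  apply/eqP/negPn/negP => g21; have g12 : g1 != g2 by rewrite eq_sym.
  by have [/disjointFr/(_ b1)] := dG _ _ g1G g2G g12; rewrite b2.
have G0 : G != set0.
  apply/negP => /eqP G0; move: Gsum; rewrite G0 big_set0 muln0 leqn0 !muln_eq0 /= cards_eq0.
  by rewrite (negPf A0) /=; nat_lia.
(* There are at least 64z|A| pairs of a tile and a vertex it sees, and at most 512z tiles see a
   given vertex; hence 1/16 of [A] is seen by 32z tiles. *)
pose Ag := [set a in A | 32 * z <= #|F a|].
have AAg : #|A| <= 16 * #|Ag|.
  have : \sum_(a in A) #|F a| <= #|Ag| * (512 * z) + #|A| * (32 * z).
    rewrite -!sum_nat_const [X in _ <= X + _]big_mkcond [X in _ <= _ + X]big_mkcond [X in X <= _]big_mkcond.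
    rewrite -big_split /=; apply: leq_sum => a _; rewrite inE.
    have [/Fle H|//] := boolP (a \in A) => /=; case: (leqP (32 * z)) => [_|/ltnW //].
    exact: leq_trans H (leq_addr _ _).
  move: Gsum; rewrite FA; move: (\sum_(a in A) _) => s H1 H2.
  rewrite -(leq_pmul2r z0); nat_lia.
pose P0 (g : {set T} * {set T} * {set T}) := hubs g :|: links g.
have cP0 g : g \in G -> conn e (P0 g) by case/tG => _ [].
have hubA (X Y : {set T}) : X \subset A -> Y \subset BT -> [disjoint X & Y].
  by move=> XA YB; apply: disjointWl XA _; apply: disjointWr YB dAT.
have dP0 g1 g2 : g1 \in G -> g2 \in G -> g1 != g2 -> [disjoint P0 g1 & P0 g2].
  move=> g1G g2G g12; have [d1 d2] := dG _ _ g1G g2G g12.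
  have [[s1 s2 _] _ _ _ _] := tG _ g1G; have [[s3 s4 _] _ _ _ _] := tG _ g2G.
  rewrite disjoint_setUl !(disjoint_sym _ (P0 _)) !disjoint_setUl.
  rewrite (disjoint_sym (hubs g2)) d1 (disjoint_sym (links g2) (links g1)) d2.
  by rewrite hubA // disjoint_sym hubA.
(* A connecting set has at most j+1 vertices in BC and j+2 in A, that is 2j+3 in all. *)
have [E X n st|P [pP cP eP]] := @extension_pack T _ e esym G P0 q (2 * j.+1).+1 (16 * z) 1024 cP0 dP0; last first.
  by exists P; rewrite -card_gt0 cP card_gt0 G0.
have [?|nfull] := leqP #|G| (1024 * #|[set g in G | n g == q]|); [by left|right].
have [s1 s2 s3 s4] := st.
pose Z := \bigcup_(g in G) E g.
have Zc : 256 * h * #|Z| <= #|A|.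
  apply: leq_trans GM; apply: leq_trans (_ : #|G| * (256 * q * (2 * j.+1).+1 * h) <= _); last first.
    by rewrite leq_mul2l muE orbT.
  have : #|Z| <= #|G| * (q * (2 * j.+1).+1).
    apply: leq_trans (card_bigcup_le _ _) _; rewrite -sum_nat_const; apply: leq_sum => g /s1[_ H nq _ _].
    by apply: leq_trans H _; rewrite leq_mul2r nq orbT.
  move: (_.+1) => w H; apply: leq_trans (_ : 256 * h * (#|G| * (q * w)) <= _); last by nat_lia.
  by rewrite leq_mul2l H orbT.
pose As := Ag :\: (LU :|: Z); pose Bs := BC :\: Z.
have AgA : Ag \subset A by apply/subsetP => a; rewrite inE => /andP[].
have AsA : As \subset A := subset_trans (subsetDl _ _) AgA.
have Asc : #|Ag| <= #|As| + #|LU| + #|Z|.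
  have := cardsID (LU :|: Z) Ag; rewrite -/As.
  have := subset_leq_card (subsetIr Ag (LU :|: Z)).
  have := leq_of_leqif (leq_card_setU LU Z); nat_lia.
(* The bound on back-degrees in [BC] enters here: each used vertex there costs at most h * 512z
   edges. *)
have EAs : #|As| * (512 * z) <= bedges RC As Bs + #|Z| * (h * (512 * z)).
  have : bedges RC As (BC :&: Z) <= #|Z| * (h * (512 * z)).
    rewrite bedgesE; apply: leq_trans (_ : \sum_(b in BC :&: Z) h * (512 * z) <= _).
      apply: leq_sum => b /setIP[/RCB H _]; apply: leq_trans H.
      exact: subset_leq_card (backS _ _ AsA).
    by rewrite sum_nat_const leq_mul2r subset_leq_card ?orbT // subsetIr.
  have : #|As| * (512 * z) <= bedges RC As (BC :&: Z) + bedges RC As Bs.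
    rewrite /bedges -big_split -sum_nat_const /=; apply: leq_sum => a /(subsetP AsA) aA.
    have [H1 /subsetP H2 _] := RCP aA; have -> : 512 * z = #|RC a| by rewrite H1; nat_lia.
    apply: leq_trans (leq_card_setU _ _); apply: subset_leq_card; apply/subsetP => b bR.
    by rewrite !inE bR H2 //=; case: (b \in Z).
  nat_lia.
have [A2 [B2 [A2A B2B degA degB]]] := core RC As Bs 1 (128 * z) (fun=> z).
rewrite !sum_nat_const !mul1n => Ecore.
have A2A' := subset_trans A2A AsA.
have A2c : #|A| <= 32 * #|A2|.
  have H1 : bedges RC A2 B2 <= #|A2| * (512 * z).
    rewrite -sum_nat_const; apply: leq_sum => a /(subsetP A2A')/RCP[H _ _].
    apply: leq_trans (subset_leq_card (subsetIl _ _)) _; nat_lia.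
  have H2 : #|Bs| * z <= #|A| * z.
    by rewrite leq_mul2r (leq_trans (subset_leq_card (subsetDl _ _)) BCA) orbT.
  have H3 : 384 * #|As| <= 384 * #|A2| + 512 * h * #|Z| + #|A|.
    rewrite -(leq_pmul2r z0); move: EAs Ecore H1 H2; nat_lia.
  have H4 : #|Z| <= h * #|Z| by rewrite leq_pmull.
  move: H3 H4 Asc LUc Zc AAg; rewrite -!mulnA; move: (h * #|Z|) => hz; nat_lia.
have dAB2 : [disjoint A2 & B2].
  by apply: disjointWl A2A' _; apply: disjointWr (subset_trans B2B (subsetDl _ _)) dAC.
(* If only finished tiles saw [A2], each seeing at most 2M = 1024 mu z vertices, they would account
   for 32z|A2| >= z|A| >= mu z|G| pairs; hence the fraction 1/1024. *)
have [/exists_inP[g gG /andP[gq /set0Pn[a0 /setIP[a0g a0A]]]]|] :=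
  boolP [exists g in G, (n g < q) && (seen g :&: A2 != set0)]; last first.
  rewrite negb_exists_in => /forall_inP H; exfalso.
  have H1 : \sum_(g in G) #|seen g :&: A2| <= #|[set g in G | n g == q]| * (2 * M).
    rewrite -sum_nat_const big_mkcond [X in _ <= X]big_mkcond /=; apply: leq_sum => g _.
    rewrite inE; have [gG|//] := boolP (g \in G); rewrite /=.
    have := H g gG; have [_ _ nq _ _] := s1 g gG; rewrite ltn_neqAle nq andbT.
    case: (n g == q) => /= [_|/negPn/eqP ->]; last by rewrite cards0.
    have [_ _ _ [_ H2 _] _] := tG g gG; apply: leq_trans H2.
    exact: subset_leq_card (subsetIl _ _).
  have H2 : #|A2| * (32 * z) <= \sum_(g in G) #|seen g :&: A2|.
    rewrite Fsum // -sum_nat_const; apply: leq_sum => a /(subsetP A2A).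
    by rewrite !inE => /andP[_ /andP[_]].
  have mz : 0 < mu * z by rewrite muln_gt0 mu0.
  have H3 : #|G| * mu * z <= #|A| * z by rewrite leq_mul2r GM orbT.
  have H4 : #|A| * z <= 32 * #|A2| * z by rewrite leq_mul2r A2c orbT.
  have : #|G| * (mu * z) <= 1024 * #|[set g in G | n g == q]| * (mu * z).
    by move: H1 H2 H3 H4; rewrite /M; nat_lia.
  by rewrite leq_pmul2r // leqNgt nfull.
have RA2 a : a \in A2 -> 128 * z <= #|RC a :&: B2| /\ forall b, b \in RC a -> e a b.
  move=> aA2; have := degA a aA2; rewrite mul1n => H; split=> //.
  by have [_ _] := RCP (subsetP A2A' _ aA2).
have RB2 b : b \in B2 -> z <= #|back RC A2 b| by move=> /degB; rewrite mul1n.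
pose Xg := g |: X g; pose Y := \bigcup_(g' in Xg) hubs g'.
have [_ _ _ Xc XG] := s1 g gG.
have XgG : Xg \subset G by rewrite subUset sub1set gG (subset_trans XG) // subD1set.
pose L := 2048 * mu * q * z.
have hubc g' : g' \in G -> #|hubs g'| <= 4 * mu.
  case/tG=> _ _ _ _ [H _]; rewrite -(leq_pmul2r (_ : 0 < 512 * z)) //; last by nat_lia.
  by move: H; rewrite /M; nat_lia.
have qz : 0 < q * z by rewrite muln_gt0 q0.
have Yc : #|Y| <= L.
  apply: leq_trans (card_bigcup_le _ _) _; apply: leq_trans (_ : #|Xg| * (4 * mu) <= _).
    by rewrite -sum_nat_const; apply: leq_sum => g' /(subsetP XgG); apply: hubc.
  have : #|Xg| <= 512 * (q * z).
    have := leq_of_leqif (leq_card_setU [set g] (X g)); rewrite cards1 Xc -/Xg.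
    have : n g * (16 * z) <= q * (16 * z) by rewrite leq_mul2r ltnW ?orbT.
    nat_lia.
  move=> H; apply: leq_trans (_ : 512 * (q * z) * (4 * mu) <= _); first by rewrite leq_mul2r H orbT.
  by rewrite /L; nat_lia.
have L0 : 0 < L by rewrite !muln_gt0 mu0 q0 z0.
have LN : 3 * L <= N by apply: leq_trans NE; rewrite /L; nat_lia.
have zN : 256 * z <= N.
  apply: leq_trans NE; have : z <= mu * q * z by rewrite leq_pmull // muln_gt0 mu0. nat_lia.
(* Vertices seen by too many tiles already linked to [g]. There are fewer than [L] of them, as [L]
   bounds the hubs of those tiles; the ball reaches [L] vertices, so it contains a vertex seen by at
   least 32z - 16z new tiles. *)
pose W := [set a in A2 | 16 * z <= #|F a :&: Xg|].
have Wc : #|W| < L.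
  have [->|W0] := eqVneq W set0; first by rewrite cards0.
  apply: leq_trans (Yc); apply: (expand_lt esym sparse (de := 16 * z)) => //.
  - apply: hubA; first by apply: subset_trans A2A'; apply/subsetP => a; rewrite inE => /andP[].
    by apply/bigcupsP => g' /(subsetP XgG)/tG[[]].
  - by move: Yc; nat_lia.
  - nat_lia.
  move=> a; rewrite inE => /andP[aA2 H]; apply: leq_trans H _.
  have aA := subsetP A2A' _ aA2; apply: leq_trans (FR a Xg aA) _; apply: dg_sub.
  by have [] := RTP aA.
pose Re := reach e A2 B2 a0 j.+1.
have Rec : L <= #|Re|.
  have [//|H] := ball_growth esym k0 sparse dAB2 zk RA2 RB2 a0A j LN zN.
  apply: leq_trans H; apply: leq_trans (_ : 16 * mu * q * (128 * z) <= _); last first.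
    by rewrite leq_mul2r jE orbT.
  by rewrite /L; nat_lia.
have /subsetPn[a1 /reachP[C [E' [CB EA Cc Ec [a1E a0E cCE]]]] a1W] : ~~ (Re \subset W).
  by apply/negP => /subset_leq_card; nat_lia.
have a1A2 := subsetP EA _ a1E; move: a1W; rewrite inE a1A2 /= -ltnNge => a1X.
have a1F : 32 * z <= #|F a1|.
  by have := subsetP A2A _ a1A2; rewrite !inE => /andP[_ /andP[_]].
have CBC : C \subset Bs := subset_trans CB B2B.
have EAs' : E' \subset As := subset_trans EA A2A.
exists g, (C :|: E'), (F a1 :\: Xg); split=> //; split.
- move=> g' g'G; have [[sH sL _] _ _ _ _] := tG g' g'G.
  rewrite !disjoint_setUl !(disjoint_sym _ (P0 g')) !disjoint_setUl.
  have -> : [disjoint hubs g' & C].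
    by apply: disjointWl sH _; apply: disjointWr (subset_trans CBC (subsetDl _ _)) dTC.
  have -> : [disjoint links g' & C].
    by apply: disjointWl sL _; apply: disjointWr (subset_trans CBC (subsetDl _ _)) dAC.
  have -> : [disjoint hubs g' & E'] by rewrite disjoint_sym; apply: hubA => //; apply: subset_trans EA A2A'.
  have sLU : links g' \subset LU by apply/bigcup_sup.
  have sZ : E g' \subset Z by apply/bigcup_sup.
  have dE : [disjoint E' & LU :|: Z].
    by rewrite disjoints_subset; apply: subset_trans EAs' _; rewrite /As setDE subsetIr.
  have -> : [disjoint links g' & E'].
    by rewrite disjoint_sym; apply: disjointWr dE; apply: subset_trans sLU (subsetUl _ _).
  have -> : [disjoint C & E g'].
    apply: disjointWr sZ _; rewrite disjoints_subset; apply: subset_trans CBC _.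
    by rewrite /Bs setDE subsetIr.
  by rewrite (disjointWr _ dE) //; apply: subset_trans sZ (subsetUr _ _).
- apply/andP; split; first by have := leq_of_leqif (leq_card_setU C E'); nat_lia.
  move: a1F; rewrite -(cardsID Xg (F a1)) => /leq_trans/(_ (leq_add (ltnW a1X) (leqnn _))).
  by rewrite -[32]/(16 + 16) mulnDl leq_add2l.
- apply: connU => //; first exact: cP0.
  have [b bg ab] := tilehub g a0 gG a0g.
  by apply/orP; right; apply/linkedP; exists b, a0; rewrite !inE bg a0E orbT esym.
- apply/subsetP => g'; rewrite !inE negb_or => /andP[/andP[-> ->] /andP[-> _]].
  by [].
move=> g'; rewrite !inE => /andP[_ /andP[g'G a1g']].
have [b bg ab] := tilehub g' a1 g'G a1g'.
by apply/linkedP; exists a1, b; rewrite !inE a1E bg orbT.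
Qed.

End Merging.

(** * The main argument *)

Lemma min_degree (T : finType) (e : rel T) (V : {set T}) D :
  symmetric e -> irreflexive e -> 0 < D -> V != set0 -> 2 * D * #|V| <= e2 e V ->
  exists2 W : {set T}, W != set0 & forall a, a \in W -> D <= dg e W a.
Proof.
move=> esym eirr D0 V0 VD.
pose P (X : {set T}) := (X != set0) && (2 * D * #|X| <= e2 e X).
have PV : P V by rewrite /P V0.
have [W /andP[W0 WD] Wmin] := arg_minnP (fun X : {set T} => #|X|) PV.
exists W => // a aW; rewrite leqNgt; apply/negP => low.
have cW : #|W| = #|W :\ a|.+1 by rewrite (cardsD1 a W) aW.
have := @e2U1 _ _ esym eirr (W :\ a) a (negbT (setD11 a W)); rewrite setD1K // => E.
have dgW : dg e (W :\ a) a <= dg e W a 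
  by apply: subset_leq_card; apply/subsetP => b; rewrite !inE => /andP[/andP[_ ->]].
have WD' : 2 * D * #|W :\ a| <= e2 e (W :\ a).
  by move: WD; rewrite cW E mulnS; nat_lia.
have nP : ~~ P (W :\ a) by apply/negP => /Wmin; rewrite cW ltnn.
move: nP; rewrite /P WD' andbT negbK => /eqP Wa0.
move: WD; rewrite cW E Wa0 cards0 {1}/e2 big_set0.
have -> : dg e set0 a = 0 by apply: eq_card0 => b; rewrite !inE.
nat_lia.
Qed.

(** Of [r] balanced classes at least half have size at most 2|W| / r; two of them become the small
    parts. These two classes and their two sets of bad vertices each take at most |W| / 8, so half
    of [W] is left for A. *)
Lemma three_parts (T : finType) (e : rel T) (W : {set T}) r x :
  16 <= r -> 16 * r <= x -> W != set0 -> (forall a, a \in W -> 2 * x * r <= dg e W a) ->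
  exists A BT BC : {set T}, exists RT RC : T -> {set T},
  [/\ A != set0, [/\ [disjoint A & BT], [disjoint A & BC] & [disjoint BT & BC]],
      r * #|BT| <= 4 * #|A| /\ r * #|BC| <= 4 * #|A|,
      forall a, a \in A -> [/\ #|RT a| = x, RT a \subset BT & forall b, b \in RT a -> e a b] &
      forall a, a \in A -> [/\ #|RC a| = x, RC a \subset BC & forall b, b \in RC a -> e a b]].
Proof.
move=> r16 rx W0 deg; have r0 : 0 < r by nat_lia.
have W0' : 0 < #|W| by rewrite card_gt0.
have [R RP] : exists R : T -> {set T}, forall a, a \in W ->
    #|R a| = 2 * x * r /\ R a \subset [set y in W | e a y].
  apply: (fin_all_exists (P := fun a (X : {set T}) => a \in W -> #|X| = _ /\ X \subset _)) => a.
  have [aW|] := boolP (a \in W); last by exists set0.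
  by have [Y] := subset_card (deg a aW); exists Y.
have [f fP] := balanced_coloring r0 (fun a aW => proj1 (RP a aW)).
pose cl i := [set b in W | f b == i].
pose bad i := [set a in W | #|R a :&: [set b | f b == i]| < x].
have clsum : \sum_i #|cl i| = #|W|.
  rewrite -sum1_card (partition_big f xpredT) //=; apply: eq_bigr => i _.
  by rewrite -sum1_card; apply: eq_bigl => b; rewrite inE.
pose S := [set i | r * #|cl i| <= 2 * #|W|].
have Sc : r <= 2 * #|S|.
  have H : #|~: S| * (2 * #|W|) <= r * #|W|.
    rewrite -{2}clsum big_distrr /= -sum_nat_const big_mkcond /=; apply: leq_sum => i _.
    by rewrite inE inE; case: (leqP (r * _)) => //= /ltnW.
  have := cardsC S; rewrite card_ord => SS; move: H; rewrite mulnA leq_pmul2r //; nat_lia.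
have /card_gt1P[i1 [i2 [i1S i2S i12]]] : 1 < #|S| by nat_lia.
pose A := W :\: (cl i1 :|: cl i2 :|: (bad i1 :|: bad i2)).
have bad8 i : 8 * #|bad i| <= #|W|.
  have := fP i; rewrite -/(bad i) => H.
  have : 16 * r * #|bad i| <= 2 * r * #|W| by apply: leq_trans H; rewrite leq_mul2r rx orbT.
  by move=> H16; rewrite -(leq_pmul2l (_ : 0 < 2 * r)); nat_lia.
have cl8 i : i \in S -> 8 * #|cl i| <= #|W|.
  rewrite inE => H; have : 16 * #|cl i| <= r * #|cl i| by rewrite leq_mul2r r16 orbT.
  nat_lia.
have WA : #|W| <= 2 * #|A|.
  have := cardsID (cl i1 :|: cl i2 :|: (bad i1 :|: bad i2)) W; rewrite -/A.
  have := subset_leq_card (subsetIr W (cl i1 :|: cl i2 :|: (bad i1 :|: bad i2))).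
  have := leq_of_leqif (leq_card_setU (cl i1 :|: cl i2) (bad i1 :|: bad i2)).
  have := leq_of_leqif (leq_card_setU (cl i1) (cl i2)).
  have := leq_of_leqif (leq_card_setU (bad i1) (bad i2)).
  have := bad8 i1; have := bad8 i2; have := cl8 _ i1S; have := cl8 _ i2S; nat_lia.
have AW : A \subset W := subsetDl _ _.
have choose i : (forall a, a \in A -> a \notin bad i) -> exists R' : T -> {set T},
    forall a, a \in A -> [/\ #|R' a| = x, R' a \subset cl i & forall b, b \in R' a -> e a b].
  move=> Abad; apply: (fin_all_exists (P := fun a (X : {set T}) => a \in A ->
    [/\ #|X| = x, X \subset cl i & forall b, b \in X -> e a b])) => a.
  have [aA|] := boolP (a \in A); last by exists set0.
  have aW := subsetP AW _ aA; have := Abad a aA; rewrite inE aW /= -leqNgt => xR.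
  have [Y YR Yx] := subset_card xR; exists Y => _; have [_ /subsetP RW] := RP a aW.
  split=> //; last by move=> b /(subsetP YR)/setIP[/RW]; rewrite inE => /andP[].
  by apply/subsetP => b /(subsetP YR)/setIP[/RW]; rewrite !inE => /andP[-> _].
have Abad a : a \in A -> a \notin bad i1 /\ a \notin bad i2.
  by rewrite inE !in_setU !negb_or => /andP[/andP[_ /andP[]]].
have [RT RTP] := choose i1 (fun a aA => proj1 (Abad a aA)).
have [RC RCP] := choose i2 (fun a aA => proj2 (Abad a aA)).
exists A, (cl i1), (cl i2), RT, RC; split=> //.
- by rewrite -card_gt0; nat_lia.
- split.
  + rewrite disjoint_sym disjoints_subset; apply/subsetP => b bc.
    by rewrite in_setC in_setD !in_setU bc.
  + rewrite disjoint_sym disjoints_subset; apply/subsetP => b bc.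
    by rewrite in_setC in_setD !in_setU bc orbT.
  rewrite disjoints_subset; apply/subsetP => b; rewrite !inE => /andP[-> /eqP ->].
  by rewrite (negPf i12).
move: i1S i2S; rewrite !inE; nat_lia.
Qed.

Section Main.
Variables (T : finType) (e : rel T) (k N s t z : nat).
Hypothesis esym : symmetric e.
Hypothesis eirr : irreflexive e.
Hypothesis k0 : 0 < k.
Hypothesis sparse : forall X : {set T}, X != set0 -> #|X| <= N -> e2 e X < 4 * k * #|X|.
Hypothesis s0 : 0 < s.
Hypothesis t0 : 0 < t.
Hypothesis tk : t <= k.
Hypothesis ts : t <= 2 ^ (s ^ 2).
Hypothesis zk : 64 * 4280 * k <= z.
(** This is 256q(2j+3)h with q = s, j = 26 + 4s and h = 80s. *)
Let mu := 256 * s * (2 * (26 + 4 * s).+1).+1 * (80 * s).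
Hypothesis muN : 6 * 1024 * mu * s * z <= N.

(** [mu] depends on j, and 2^j has to exceed 16 mu s. A linear j closes the circle: [mu] is at most
    cubic in s, s^4 <= 2^(4s), and 2^26 covers the constant. *)
Lemma mu_small : 16 * mu * s <= 2 ^ (26 + 4 * s).
Proof.
have H (m : nat) : m <= 2 ^ m by apply/ltnW/ltn_expl.
have s4 : s * s * (s * s) <= 2 ^ (4 * s).
  rewrite (_ : 4 * s = s + s + (s + s)); last by nat_lia.
  by rewrite !expnD !leq_mul.
have s16 a b c : 2 ^ a * 2 ^ b * 2 ^ c * (s * s * (s * s)) <= 2 ^ (a + b + c + 4 * s).
  by rewrite 3!expnD; apply: leq_mul.
have {s16} : 2 ^ 12 * 2 ^ 12 * 2 ^ 2 * (s * s * (s * s)) <= 2 ^ (26 + 4 * s) := s16 12 12 2.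
apply: leq_trans.
have : (2 * (26 + 4 * s).+1).+1 <= 63 * s by nat_lia.
rewrite /mu (_ : 2 ^ 12 = 4 * 1024) //; move: (_.+1) => w ws.
apply: leq_trans (_ : 16 * (256 * s * (63 * s) * (80 * s)) * s <= _).
  by rewrite !leq_mul.
rewrite (_ : 2 ^ 2 = 4) //; nat_lia.
Qed.

(** This fixes z: (s+3)t <= 4sk, and 16 * 64 * 4280 = 1024 * 1070 * 4. *)
Lemma dense_pack_sparse (P : {set {set T}}) : pack e P -> P != set0 ->
  #|P| * (s * (16 * z)) <= 1024 * e2 (setadj e) P -> model e t.
Proof.
move=> pP P0 H; apply: (dense_pack_model esym pP P0 t0 ts).
rewrite -(leq_pmul2l (_ : 0 < 1024)) //; apply: leq_trans H.
have skz : s * (64 * 4280 * k) <= s * z by rewrite leq_mul2l zk orbT.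
have st : (s + 3) * t <= 4 * s * k by apply: leq_mul => //; nat_lia.
have : 1024 * (1070 * ((s + 3) * t)) <= s * (16 * z) by nat_lia.
move=> H; apply: leq_trans (_ : #|P| * (1024 * (1070 * ((s + 3) * t))) <= _).
  by rewrite mulnA mulnC.
by rewrite leq_mul2l H orbT.
Qed.

Lemma sparse_model (V : {set T}) : V != set0 ->
  2 * (2 * (8 * (128 * z)) * (4 * 1024)) * #|V| <= e2 e V -> model e t.
Proof.
move=> V0 VD; have z0 : 0 < z by nat_lia.
have [|W W0 Wdeg] := min_degree esym eirr _ V0 VD; first by nat_lia.
(* r = 4 * 1024 makes 1024|BT| <= |A|, which leaves 256|BT| <= |A2| after two halvings of A. The
   degree 8 * 128z is halved by [split_hubs] to 8 * 64z, and its bound 320 * s * 128z on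
   back-degrees is 80s * 512z. *)
have [||A [BT [BC [RT [RC [A0 [dAT dAC dTC] [BTA BCA] RTP RCP]]]]]] := three_parts _ _ W0 Wdeg.
- by [].
- by nat_lia.
have x4 : 4 * k < 128 * z by nat_lia.
have mu0 : 0 < mu by rewrite /mu !muln_gt0 s0.
have sxN : 4 * s * (128 * z) <= N.
  apply: leq_trans muN; have : s * z <= mu * (s * z) by rewrite leq_pmull.
  rewrite -!mulnA; nat_lia.
have pack2 (P : {set {set T}}) : pack e P -> P != set0 ->
    #|P| * (s * (128 * z)) <= 2 * e2 (setadj e) P -> model e t.
  move=> pP P0 H; apply: (dense_pack_sparse pP P0).
  apply: leq_trans (_ : 512 * (#|P| * (s * (128 * z))) <= _); first by nat_lia.
  by nat_lia.
have [[P [pP P0 H]]|[A1 [RT1 [A1A A1c RT1P RT1B]]]] :=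
  split_hubs esym k0 sparse dAT s0 x4 sxN A0 RTP; first exact: pack2 H.
have A10 : A1 != set0 by move: A1c A0; rewrite -!card_gt0; nat_lia.
have dA1 (X : {set T}) : [disjoint A & X] -> [disjoint A1 & X] by apply: disjointWl.
have RCP1 a : a \in A1 -> _ := fun aA1 => RCP a (subsetP A1A a aA1).
have [[P [pP P0 H]]|[A2 [RC2 [A2A1 A2c RC2P RC2B]]]] :=
  split_hubs esym k0 sparse (dA1 _ dAC) s0 x4 sxN A10 RCP1; first exact: pack2 H.
have A2A := subset_trans A2A1 A1A.
have [P [pP P0 H]] : exists P, [/\ pack e P, P != set0 & #|P| * (s * (16 * z)) <= 1024 * e2 (setadj e) P].
  apply: (@merge_tiles _ e k N esym k0 sparse A2 BT BC RT1 RC2 z mu s (26 + 4 * s) (80 * s)) => //.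
  - exact: disjointWl A2A dAT.
  - exact: disjointWl A2A dAC.
  - by move: A2c A10; rewrite -!card_gt0; nat_lia.
  - by nat_lia.
  - by nat_lia.
  - by nat_lia.
  - move=> a aA2; have aA1 := subsetP A2A1 a aA2; have [c1 c2 /subsetP c3] := RT1P a aA1.
    have [_ _ c4] := RTP a (subsetP A1A a aA1).
    by split=> // [|b /c3/c4//]; rewrite c1; nat_lia.
  - move=> a aA2; have [c1 c2 /subsetP c3] := RC2P a aA2.
    have [_ _ c4] := RCP a (subsetP A2A a aA2).
    by split=> // [|b /c3/c4//]; rewrite c1; nat_lia.
  - move=> b /RT1B H; have := subset_leq_card (backS RT1 b A2A1); nat_lia.
  - move=> b /RC2B H; nat_lia.
  - by rewrite muln_gt0.
  exact: mu_small.
exact: dense_pack_sparse H.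
Qed.

End Main.

Lemma double_edges (T : finType) (G : sgraph T) : 2 * #|edges G| <= e2 (adj G) (vertices G).
Proof.
have -> : 2 * #|edges G| = \sum_(x in vertices G) #|[set E in edges G | x \in E]|.
  rewrite mulnC -sum_nat_const; under [RHS]eq_bigr do rewrite -sum1_card.
  rewrite (exchange_big_dep (mem (edges G))) /=; last by move=> x E _; rewrite inE => /andP[].
  apply: eq_bigr => E EG; have /andP[/subsetP sub /eqP cE] := forall_inP (edges_wf G) E EG.
  rewrite -{1}cE -sum1_card; apply: eq_bigl => x; rewrite inE EG andbC /=.
  by case xE: (x \in E) => //=; rewrite sub.
apply: leq_sum => x _.
apply: leq_trans (leq_imset_card (fun y => [set x; y]) _); apply: subset_leq_card.
apply/subsetP => E; rewrite inE => /andP[EG xE].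
have /andP[/subsetP sub /eqP cE] := forall_inP (edges_wf G) E EG.
have : #|E :\ x| == 1 by move: cE; rewrite (cardsD1 x) xE => /eqP.
case/cards1P => y Ey; have E2 : E = [set x; y] by rewrite -(setD1K xE) Ey.
apply/imsetP; exists y => //; rewrite inE /adj -E2 EG andbT sub //.
by rewrite E2 set22.
Qed.

Lemma complete_minor1 (T : finType) (G : sgraph T) : vertices G != set0 -> has_complete_minor 1 G.
Proof.
case/set0Pn => x xG; have V1 : vertices (del_vertices G (~: [set x])) = [set x].
  by apply/setP => y; rewrite !inE negbK; case: eqP => // ->.
exists (del_vertices G (~: [set x])), (del_vertices G (~: [set x])).
split; [exact: del_subgraph|exact: contraction_refl| |by rewrite V1 cards1].
by move=> y z; rewrite V1 !inE => /eqP -> /eqP ->; rewrite eqxx.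
Qed.

Lemma small_k_connected : exists c D : nat, forall (T : finType) (G : sgraph T) k s t,
  1 < t -> 0 < s -> t <= k -> t <= 2 ^ (s ^ 2) -> vertices G != set0 ->
  D * k * #|vertices G| <= #|edges G| -> ~ has_complete_minor t G ->
  exists H, [/\ subgraph H G, vertices H != set0, k_connected k H & #|vertices H| <= c * t * s ^ 6].
Proof.
exists (6 * 1024 * (256 * 63 * 80) * (64 * 4280)), (2 * (8 * (128 * (64 * 4280))) * (4 * 1024)).
move=> T G k s t t1 s0 tk ts V0 dV nminor.
have k0 : 0 < k by nat_lia.
set e := adj G; have esym : symmetric e := @adj_sym _ G; have eirr : irreflexive e := @adj_irr _ G.
have nomodel : ~ model e t by move/(model_minor t1).
have eV : 2 * (2 * (8 * (128 * (64 * 4280 * k))) * (4 * 1024)) * #|vertices G| <= e2 e (vertices G).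
  apply: leq_trans (double_edges G); rewrite -mulnA leq_mul2l /=; apply: leq_trans dV; nat_lia.
have [stk|kst] := leqP (s * t) k.
  case: nomodel.
  have [||||pP cP eP] := @family_pack T T e (vertices G) set1 (fun x => [set y in vertices G | e x y]).
  - by move=> x _; apply: conn1.
  - by move=> x y _ _ xy; rewrite disjoints1 inE.
  - by move=> x _; apply/subsetP => y; rewrite !inE => /andP[-> xy]; rewrite andbT; apply: contraTneq xy => ->; rewrite eirr.
  - by move=> x y _; rewrite inE => /andP[_ xy]; apply/linkedP; exists x, y; rewrite !set11.
  apply: (dense_pack_model esym pP _ _ ts); [by rewrite -card_gt0 cP card_gt0|by nat_lia|].
  apply: leq_trans eP; rewrite cP; apply: leq_trans eV; rewrite leq_mul2r; apply/orP; right.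
  have : (s + 3) * t <= 4 * s * t by rewrite leq_mul2r; nat_lia.
  nat_lia.
apply: NNPP => none; case: nomodel.
pose mu := 256 * s * (2 * (26 + 4 * s).+1).+1 * (80 * s).
have muE : 6 * 1024 * mu * s * (64 * 4280 * k) <= 6 * 1024 * (256 * 63 * 80) * (64 * 4280) * t * s ^ 6.
  have ws : (2 * (26 + 4 * s).+1).+1 <= 63 * s by nat_lia.
  rewrite /mu; move: (_.+1) ws => w ws.
  apply: leq_trans (_ : 6 * 1024 * (256 * s * (63 * s) * (80 * s)) * s * (64 * 4280 * (s * t)) <= _).
    by rewrite !leq_mul // ltnW.
  apply: leq_trans (_ : 6 * 1024 * (256 * 63 * 80) * (64 * 4280) * t * s ^ 5 <= _).
    rewrite !expnS expn0; nat_lia.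
  (* The argument gives s^5; s^6 makes the power of s^2 an integer, as the cube of the logarithm
     needs. *)
  by rewrite leq_mul2l leq_pexp2l ?orbT.
apply: (@sparse_model T e k _ s t (64 * 4280 * k) esym eirr k0 _ s0 _ tk ts (leqnn _) muE _ V0 eV); last by nat_lia.
move=> X X0 Xc; rewrite ltnNge; apply/negP => dX.
(* [X] may contain elements outside the graph; they carry no edges. *)
have XV : e2 e X <= e2 e (X :&: vertices G).
  rewrite {1}/e2 (big_setID (vertices G)) /= [X in _ + X]big1 ?addn0.
    apply: leq_sum => x _; apply: subset_leq_card; apply/subsetP => y; rewrite !inE => /andP[-> xy].
    by rewrite xy andbT; case/andP: (adj_vertices xy).
  move=> x /setDP[_ xV]; apply: eq_card0 => y; rewrite inE; apply/negP => /andP[_ xy].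
  by case/andP: (adj_vertices xy); rewrite (negPf xV).
have cX : #|X :&: vertices G| <= #|X| by apply/subset_leq_card/subsetIl.
have [||H [H1 H2 H3 H4]] := mader_k_connected k0 _ (subsetIr X (vertices G)).
- apply/negP => /eqP XV0; move: XV dX; rewrite XV0 {2}/e2 big_set0 leqn0 => /eqP ->.
  by rewrite leqn0 !muln_eq0 cards_eq0 (negPf X0) /=; nat_lia.
- by apply: leq_trans XV; apply: leq_trans dX; rewrite leq_mul2l cX orbT.
case: none; exists H; split=> //; apply: leq_trans Xc.
by apply: leq_trans (subset_leq_card H4) cX.
Qed.

(** * From powers of s to logarithms *)

Import Order.TTheory GRing.Theory Num.Theory.
Local Open Scope ring_scope.

Lemma ln2_ge (R : realType) : 2^-1 <= ln (2 : R).
Proof.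
have : ln (1 + - 2^-1 : R) <= - 2^-1 by apply: le_ln1Dx; lra.
by rewrite (_ : 1 + - 2^-1 = 2^-1 :> R); [rewrite lnV ?posrE ?ltr0n ?lerN2|lra].
Qed.

(** For the least such s >= 2, (s-1)^2 ln 2 <= ln t; then s <= 2(s-1) and ln 2 >= 1/2 give s^2 <= 8
    ln t. For s = 1 the bound follows from ln t >= 1/2. *)
Lemma square_root_log (R : realType) t : (1 < t)%N ->
  exists s, [/\ (0 < s)%N, (t <= 2 ^ (s ^ 2))%N & s%:R ^+ 2 <= 8 * ln (t%:R : R)].
Proof.
move=> t1.
have ex : exists s, (0 < s)%N && (t <= 2 ^ (s ^ 2))%N.
  exists t; rewrite (ltnW t1) /=; apply: ltnW; apply: leq_trans (ltn_expl t (ltnSn 1)) _.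
  by rewrite leq_exp2l // -{1}(expn1 t) leq_pexp2l // ltnW.
have [s /andP[s0 ts] smin] := ex_minnP ex; exists s; split=> //.
have t1' : (1 : R) < t%:R by rewrite ltr1n.
have t2 : (2 : R) <= t%:R by rewrite ler_nat.
have l2 := ln2_ge R.
have lt : ln 2 <= ln (t%:R : R) by rewrite ler_ln ?posrE ?ltr0n // ltnW.
case: s s0 ts smin => // -[|r] _ _ smin; first by rewrite expr1n; lra.
have : (2 ^ (r.+1 ^ 2) < t)%N.
  by rewrite ltnNge; apply/negP => h; have := smin r.+1; rewrite h => /(_ isT); rewrite ltnn.
rewrite -(ltr_nat R) natrX => /ltW; rewrite -ler_ln ?posrE ?exprn_gt0 ?ltr0n ?(ltnW t1) //.
rewrite lnXn ?ltr0n // -[ln _ *+ _]mulr_natl natrX => H.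
have r1 : (1 : R) <= r.+1%:R by rewrite ler1n.
rewrite -[r.+2]addn1 natrD; move: H r1; move: (r.+1%:R) => x H x1.
have x2 : x ^+ 2 * 2^-1 <= ln (t%:R : R) by apply: le_trans H; rewrite ler_wpM2l ?sqr_ge0.
nra.
Qed.

Theorem theorem2p3 (R : realType) :
  exists C : nat, (1 <= C)%N /\
    forall t : nat, (1 <= t)%N ->
    forall k : nat, (t <= k)%N ->
    forall (T : finType) (G : sgraph T),
      vertices G != set0 ->
      C%:R * k%:R <= density R G ->
      ~ has_complete_minor t G ->
      exists H : sgraph T,
        [/\ subgraph H G,
            vertices H != set0,
            k_connected k H
          & #|vertices H|%:R <= C%:R ^+ 2 * t%:R * ln (t%:R : R) ^+ 3].
Proof.
(* 512 = 8^3 comes from s^6 <= (8 ln t)^3; the sum is at least [D], and its square at least 512c. *)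
have [c [D small]] := small_k_connected; exists (c + D + 512)%N; split; first by lia.
move=> t t0 k tk T G V0 dG nminor.
have V0' : (0 : R) < #|vertices G|%:R by rewrite ltr0n card_gt0.
have Vk : (D * k * #|vertices G| <= #|edges G|)%N.
  move: dG; rewrite /density ler_pdivlMr // -!natrM ler_nat; apply: leq_trans.
  by rewrite !leq_mul2r -addnA addnCA leq_addr !orbT.
(* For t = 1 the required bound is 0, but a nonempty graph has a K_1 minor. *)
have [t1|t1] := leqP t 1.
  by case: nminor; have -> : t = 1%N by [lia]; apply: complete_minor1.
have [s [s0 ts sln]] := square_root_log R t1.
have [H [H1 H2 H3 H4]] := small T G k s t t1 s0 tk ts V0 Vk nminor.
exists H; split=> //; apply: le_trans (_ : (c * t * s ^ 6)%:R <= _); first by rewrite ler_nat.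
have ln0 : 0 <= ln (t%:R : R) by rewrite ln_ge0 // ler1n ltnW.
have s6 : (s%:R : R) ^+ 6 <= 512 * ln (t%:R : R) ^+ 3.
  rewrite (_ : 512 * _ = (8 * ln (t%:R : R)) ^+ 3); last by rewrite exprMn; congr (_ * _); ring.
  by rewrite (exprM _ 2 3) lerXn2r ?nnegrE ?sqr_ge0 ?mulr_ge0.
have cC m : (c%:R * m%:R : R) <= (c + D + m)%:R ^+ 2.
  by rewrite -natrX -natrM ler_nat expnS expn1 leq_mul ?leq_addl // -addnA leq_addr.
rewrite (natrM _ (c * t)) (natrM _ c) natrX; apply: le_trans (_ : c%:R * t%:R * (512 * ln t%:R ^+ 3) <= _).
  by rewrite ler_wpM2l // mulr_ge0.
rewrite (_ : c%:R * t%:R * (512 * ln t%:R ^+ 3) = (c%:R * 512) * t%:R * ln t%:R ^+ 3); last by ring.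
by rewrite ler_wpM2r ?exprn_ge0 // ler_wpM2r.
Qed.
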